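(* Let $d\in\mathbb N$ and let $p\in\mathbb Z[x_1,\dots,x_d]$ be a non-constant, non-linear polynomial with zero constant term. Then there exist an invertible, weakly mixing probability preserving system $(X,\mathcal A,\mu,T)$, a set $A\in\mathcal A$ with $\mu(A)>0$, and an $\epsilon>0$, for which the set $$\{\vec n\in\mathbb Z^d\,|\,\mu(A\cap T^{-p(\vec n)}A)>(\mu(A))^2-\epsilon\}$$ is not IP$_0^*$.
   Context: $\mathbb N=\{1,2,\dots\}$. An invertible probability preserving system $(X,\mathcal A,\mu,T)$ (probability space with an invertible $\mu$-preserving transformation $T$) is weakly mixing if $\lim_{N-M\to\infty}\frac1{N-M}\sum_{n=M+1}^N|\mu(A\cap T^{-n}B)-\mu(A)\mu(B)|=0$ for any $A,B\in\mathcal A$. For $r\in\mathbb N$ and distinct $\vec n_1,\dots,\vec n_r\in\mathbb Z^d$, the set $\{\vec n_{j_1}+\cdots+\vec n_{j_t}\,|\,1\le j_1<\cdots<j_t\le r,\ t\ge 1\}$ is called an IP$_r$ set. A set $E\subseteq\mathbb Z^d$ is IP$_r^*$ if $E\cap D\neq\emptyset$ for every IP$_r$ set $D\subseteq\mathbb Z^d$; it is IP$_0^*$ if it is IP$_r^*$ for some $r\in\mathbb N$. *)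

(* Defs.v *)
From HB Require Import structures.
From mathcomp Require Import all_boot all_order all_algebra.
From mathcomp Require Import all_classical all_reals all_analysis.
From mathcomp.multinomials Require mpoly.
(* The notations of mpoly clash with those of mathcomp-analysis. *)
Import -(notations) mpoly.

Set Implicit Arguments.
Unset Strict Implicit.
Unset Printing Implicit Defensive.

Import Order.TTheory GRing.Theory Num.Theory.
Import numFieldNormedType.Exports.

Local Open Scope classical_set_scope.
Local Open Scope ring_scope.

Section InvertibleSystems.
Context {R : realType} {disp : measure_display} {X : measurableType disp}.
Variable mu : probability X R.

(* The inverse map is data, so that negative powers are definable; that it
   preserves mu follows from the fields below. *)
Record invertible_mpt := InvertibleMPT {
  mpt_fwd :> X -> X ;
  mpt_bwd : X -> X ;
  mpt_fwdK : cancel mpt_fwd mpt_bwd ;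
  mpt_bwdK : cancel mpt_bwd mpt_fwd ;
  measurable_mpt_fwd : measurable_fun setT mpt_fwd ;
  measurable_mpt_bwd : measurable_fun setT mpt_bwd ;
  mpt_preserving : forall A : set X, measurable A ->
    mu (mpt_fwd @^-1` A) = mu A }.

(* T^n for n in Z; note that Negz k is -(k+1). *)
Definition mpt_pow (T : invertible_mpt) (n : int) : X -> X :=
  match n with
  | Posz k => iter k (mpt_fwd T)
  | Negz k => iter k.+1 (mpt_bwd T)
  end.

(* mu takes values in \bar R; being a probability measure it is finite, so
   nothing is lost by fine. *)
Definition correlation_defect (T : invertible_mpt) (A B : set X) (n : int) : R :=
  `|fine (mu (A `&` mpt_pow T n @^-1` B)) - fine (mu A) * fine (mu B)|.

(* The limit along N - M --> +oo is uniform in M: the window M < n <= N is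
   parametrized by its left end M and its length L = N - M. *)
Definition weakly_mixing (T : invertible_mpt) : Prop :=
  forall A B : set X, measurable A -> measurable B ->
  forall e : R, 0 < e ->
  \forall L \near \oo, forall M : int,
    `|L%:R^-1 * \sum_(1 <= k < L.+1) correlation_defect T A B (M + k%:Z)| < e.

End InvertibleSystems.

Section IPSets.
Variable d : nat.
Implicit Types D E : set 'rV[int]_d.

Definition is_IP (r : nat) D : Prop :=
  exists2 n : 'I_r -> 'rV[int]_d, injective n &
    D = [set \sum_(j in J) n j | J in [set J : {set 'I_r} | J != finset.set0]].

Definition is_IP_star (r : nat) E : Prop :=
  forall D, is_IP r D -> E `&` D !=set0.

Definition is_IP0_star E : Prop :=
  exists2 r : nat, (0 < r)%N & is_IP_star r E.

End IPSets.

Section IntegerPolynomials.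
Variable d : nat.

(* msize is the total degree plus one (and 0 for the zero polynomial). *)
Definition nonconstant (p : mpoly d int) : Prop :=
  (1 < msize p)%N.

Definition nonlinear (p : mpoly d int) : Prop :=
  msize p <> 2%N.

Definition zero_constant_term (p : mpoly d int) : Prop :=
  mcoeff mnm0 p = 0.

Definition eval_at (p : mpoly d int) (n : 'rV[int]_d) : int :=
  meval (fun i => n ord0 i) p.

End IntegerPolynomials.

(* Main.v *)
(* View points of the space as two-valued sequences f on Z.  It suffices to find
   a stationary measure on them, invariant under negation, that is weakly mixing
   and such that for every r there is an IP_r set D for which the probability of
   f 0 = f (p n) is close to 1/4 for all n in D; then A = {f 0} works.

   Restricting p to a line turns it into P(t) = c t^D + ... with D >= 2.  Choose
   integers y_0 << y_1 << ..., each divisible by high powers of the previous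
   ones, and for y = y_2q, y' = y_2q+1 multiply together the three square waves
   of half-periods |c| y^D, |c| D y^(D-1) y' and |c| y'^D.  For
   t = sum_j s_j y_j the translation by P(t) changes the signs of these waves,
   up to a small error, according to the parities of s, s s' and s', where
   s = s_2q and s' = s_2q+1.  Let (S_2q, S_2q+1) run through all pairs of subsets
   of {1..r} and put t_i = sum_(j | i in S_j) y_j.  For a nonempty partial sum of
   the t_i, the pair (s, s') modulo 2 is uniformly distributed over q, so that
   the product of the waves changes sign (s + s s' + s' is odd) for 3/4 of the q.

   Given a process, a new one is obtained by concatenating periodically two
   independent long blocks of it, multiplying by the slow wave of a random q,
   and choosing a random phase.  It looks like the old one in small windows,
   it is almost independent at distance one block length, and it has the wanted
   return probabilities for one r.  Iterating gives a limit process which has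
   them for all r and mixes along a sequence of times.  Such a sequence yields
   arbitrarily many almost independent translates of any event, so weak mixing
   follows from Bessel's inequality. *)

Require Import Defs.
From HB Require Import structures.
From mathcomp Require Import all_boot all_order all_algebra.
From mathcomp Require Import all_classical all_reals all_analysis.
From mathcomp Require Import zify ring lra.
From mathcomp.multinomials Require mpoly.
Import -(notations) mpoly.

Set Implicit Arguments.
Unset Strict Implicit.
Unset Printing Implicit Defensive.

Import Order.TTheory GRing.Theory Num.Theory.
Import numFieldNormedType.Exports.

Local Open Scope ring_scope.

(** * Polynomials over the integers *)

Definition oddz (e : int) : bool := odd `|e|%N.

Lemma oddzD a b : oddz (a + b) = oddz a (+) oddz b.
Proof. rewrite /oddz; lia. Qed.

Lemma oddz_nat (n : nat) : oddz n%:Z = odd n.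
Proof. by []. Qed.

Lemma oddzM a b : oddz (a * b) = oddz a && oddz b.
Proof. by rewrite /oddz abszM oddM. Qed.

Lemma horner_subz_dvd (F : {poly int}) (a b : int) :
  exists k, F.[a] = F.[b] + (a - b) * k.
Proof.
elim/poly_ind: F => [|F c [k Fk]]; first by exists 0; rewrite !horner0; ring.
exists (F.[b] + a * k); rewrite !hornerMXaddC Fk; ring.
Qed.

Lemma horner_taylor2 (F : {poly int}) (a b : int) :
  exists k, F.[a + b] = F.[a] + b * F^`().[a] + b ^+ 2 * k.
Proof.
elim/poly_ind: F => [|F c [k Fk]].
  by exists 0; rewrite deriv0 !horner0; ring.
exists (F^`().[a] + (a + b) * k).
have -> : (F * 'X + c%:P)^`().[a] = F^`().[a] * a + F.[a].
  by rewrite derivD derivM derivX derivC addr0 mulr1 !hornerE.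
rewrite !hornerMXaddC Fk; ring.
Qed.

(** The error of the leading term has order [(u + 1)^E y^(E-1)]; both sides carry an extra factor
    [y] to avoid the exponent [E - 1]. In a Horner step the old error is multiplied by
    [x = s y + u <= (r + 1) (u + 1) y], while the new terms [A S Y u] and [c] are already of lower
    order in [y]. *)
Lemma horner_leading_bound (F : {poly int}) (E r : nat) : (size F <= E.+1)%N ->
  exists2 C : int, 0 <= C & forall (u y : int) (s : nat), 0 <= u -> 1 <= y -> (s <= r)%N ->
    `|F.[s%:Z * y + u] - F`_E * s%:Z ^+ E * y ^+ E| * y
      <= C * (u + 1) ^+ E * y ^+ E.
Proof.
elim/poly_ind: F E => [|F c IH] E sF.
  exists 0 => // u y s u0 y1 sr; by rewrite horner0 coef0 !mul0r.
case: E sF => [|E] sF.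
  exists 0 => // u y s u0 y1 sr.
  move: sF => /size1_polyC ->.
  by rewrite hornerC coefC eqxx !expr0 !mulr1 subrr normr0 mul0r.
have sF' : (size F <= E.+1)%N.
  by move: sF; rewrite size_MXaddC; case: ifP => // /andP[/eqP-> _]; rewrite size_poly0.
have [C C0 HC] := IH _ sF'.
exists (C * (r%:Z + 1) + `|F`_E| * r%:Z ^+ E + `|c|).
  by rewrite !addr_ge0 ?mulr_ge0 // exprn_ge0.
move=> u y s u0 y1 sr; have {}HC := HC u y s u0 y1 sr.
rewrite hornerMXaddC coefD coefMX coefC /= addr0.
set x := s%:Z * y + u in HC *.
set Y := y ^+ E in HC *; set V := (u + 1) ^+ E in HC *.
set A := F`_E in HC *; set S := s%:Z ^+ E in HC *.
have Y1 : 1 <= Y by rewrite exprn_ege1.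
have V1 : 1 <= V by rewrite exprn_ege1 //; lia.
have S0 : 0 <= S by rewrite exprn_ge0.
have Sr : S <= r%:Z ^+ E by rewrite lerXn2r ?nnegrE ?lez_nat.
have -> : F.[x] * x + c - A * s%:Z ^+ E.+1 * y ^+ E.+1 =
  (F.[x] - A * S * Y) * x + A * S * Y * u + c.
  by rewrite !exprS -/S -/Y /x; ring.
have x0 : 0 <= x by rewrite /x addr_ge0 // mulr_ge0 //; lia.
have xb : x <= (r%:Z + 1) * ((u + 1) * y).
  have : s%:Z <= r%:Z; first by rewrite lez_nat.
  rewrite /x; nia.
have uy1 : 1 <= (u + 1) * y by nia.
have VY1 : 1 <= V * Y by nia.
have h1 : `|(F.[x] - A * S * Y) * x| * y <= C * V * Y * ((r%:Z + 1) * ((u + 1) * y)).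
  rewrite normrM (ger0_norm x0) mulrAC.
  by apply: ler_pM => //; rewrite mulr_ge0 //; lia.
have h2 : `|A * S * Y * u| * y <= `|A| * r%:Z ^+ E * (V * Y * ((u + 1) * y)).
  rewrite !normrM (ger0_norm S0) (ger0_norm u0) (_ : `|Y| = Y); last by rewrite ger0_norm; lia.
  have -> : `|A| * S * Y * u * y = (`|A| * S) * (Y * (u * y)) by ring.
  apply: ler_pM; [by rewrite mulr_ge0|by nia|by rewrite ler_wpM2l|].
  have -> : V * Y * ((u + 1) * y) = Y * (V * ((u + 1) * y)) by ring.
  apply: ler_wpM2l; first lia.
  nia.
have h3 : `|c| * y <= `|c| * (V * Y * ((u + 1) * y)).
  apply: ler_wpM2l => //; nia.
apply: (@le_trans _ _ ((`|(F.[x] - A * S * Y) * x| + `|A * S * Y * u| + `|c|) * y)).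
  apply: ler_wpM2r; first lia.
  by rewrite (le_trans (ler_normD _ _)) // lerD2r ler_normD.
rewrite !exprS -/V -/Y.
move: h1 h2 h3; set a := `|(_ - _) * x|; set b := `|A * S * Y * u|; set R := r%:Z ^+ E.
move=> h1 h2 h3.
have -> : (C * (r%:Z + 1) + `|A| * R + `|c|) * ((u + 1) * V) * (y * Y) =
  C * V * Y * ((r%:Z + 1) * ((u + 1) * y)) +
  `|A| * R * (V * Y * ((u + 1) * y)) + `|c| * (V * Y * ((u + 1) * y)) by ring.
have -> : (a + b + `|c|) * y = a * y + b * y + `|c| * y by ring.
by apply: lerD => //; apply: lerD.
Qed.

Lemma poly_int_nonroot (F : {poly int}) : F != 0 -> exists b : int, F.[b] != 0.
Proof.
move=> F0; pose s := [seq i%:Z | i <- iota 0 (size F)].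
have us : uniq s by rewrite map_inj_uniq ?iota_uniq // => i j [].
have : ~~ all (root F) s.
  by apply/negP => /(max_poly_roots F0)/(_ us); rewrite size_map size_iota ltnn.
by move=> /allPn[b _ Fb]; exists b.
Qed.

Lemma base_digits_inj (b d : nat) (m1 m2 : 'I_d -> nat) :
  (forall i, (m1 i < b)%N) -> (forall i, (m2 i < b)%N) ->
  (\sum_i m1 i * b ^ i = \sum_i m2 i * b ^ i)%N -> m1 =1 m2.
Proof.
elim: d m1 m2 => [|d IH] m1 m2 b1 b2; first by move=> _ [].
have tail (m : 'I_d.+1 -> nat) : (\sum_i m i * b ^ i =
    m ord0 + b * \sum_i m (lift ord0 i) * b ^ i)%N.
  rewrite big_ord_recl expn0 muln1; congr (_ + _)%N.
  by rewrite big_distrr; apply: eq_bigr => i _ /=; rewrite /bump /= add1n expnS; lia.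
rewrite !tail => e.
have e0 : m1 ord0 = m2 ord0.
  have := congr1 (modn^~ b) e.
  by rewrite /= ![(b * _)%N]mulnC ![(_ + _ * b)%N]addnC !modnMDl !modn_small.
have b0 : (0 < b)%N by have := b1 ord0; case: (b).
have e1 : m1 \o lift ord0 =1 m2 \o lift ord0.
  apply: IH => [i|i|] //=.
  by move: e; rewrite e0 => /addnI/eqP; rewrite eqn_pmul2l // => /eqP.
move=> i; case: (unliftP ord0 i) => [j ->|-> //]; exact: e1.
Qed.

(** Kronecker substitution: with [v_i = b^((D+1)^i)] the exponents of a monomial, being at most [D],
    are digits in base [D + 1]. Distinct monomials of top degree thus become distinct powers of [b],
    and the coefficient of [t^D] in [P] is the value at [b] of a nonzero polynomial. *)
Lemma mpoly_line_reduction d (p : mpoly d int) : (2 < msize p)%N ->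
  exists (v : 'I_d -> int) (P : {poly int}), (2 < size P)%N /\
    forall t : int, P.[t] = meval (fun i => t * v i) p.
Proof.
move=> sp; set D := (msize p).-1.
have p0 : p != 0 by rewrite -msize_poly_eq0 -lt0n; lia.
pose m0 := mlead p; have m0p : m0 \in msupp p := mlead_supp p0.
have m0D : mdeg m0 = D by rewrite /D -(mlead_deg p0).
pose k (m : multinom d) := (\sum_(i < d) m i * D.+1 ^ i)%N.
have mD m : m \in msupp p -> (mdeg m <= D)%N.
  by move=> /msize_mdeg_lt; rewrite /D; lia.
have k_inj m : m \in msupp p -> k m = k m0 -> m = m0.
  move=> mp km; apply/mnmP; apply: (base_digits_inj _ _ km) => i; rewrite ltnS.
    by rewrite (leq_trans _ (mD _ mp)) // mdegE (bigD1 i) //= leq_addr.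
  by rewrite -m0D mdegE (bigD1 i) //= leq_addr.
(* The top homogeneous part of [p] after the substitution; its coefficient at [k m0] is the leading
   coefficient of [p]. *)
pose F : {poly int} := \sum_(m <- msupp p | mdeg m == D) mcoeff m p *: 'X^(k m).
have F0 : F != 0.
  apply/eqP => /(congr1 (fun G : {poly int} => G`_(k m0))).
  rewrite coef0 coef_sum big_mkcond (bigD1_seq m0) ?msupp_uniq //= m0D eqxx.
  rewrite coefZ coefXn eqxx mulr1 big1_seq ?addr0 => [/eqP|m /andP[mm0 mp]].
    by rewrite mleadc_eq0 (negPf p0).
  case: ifP => // _; rewrite coefZ coefXn; case: eqP => [kk|_]; last by rewrite mulr0.
  by rewrite (k_inj m mp) ?eqxx // in mm0.
have [b Fb] := poly_int_nonroot F0.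
pose v (i : 'I_d) : int := b ^+ (D.+1 ^ i).
pose P : {poly int} := \sum_(m <- msupp p)
  (mcoeff m p * \prod_(i < d) v i ^+ m i) *: 'X^(mdeg m).
have vE (m : multinom d) : \prod_(i < d) v i ^+ m i = b ^+ k m.
  by rewrite -prodrXr; apply: eq_bigr => i _; rewrite /v -exprM mulnC.
exists v, P; split; last first.
  move=> t; rewrite mevalE horner_sum; apply: eq_bigr => m _.
  rewrite hornerZ hornerXn -mulrA; congr (_ * _).
  rewrite mdegE -prodrXr -big_split; apply: eq_bigr => i _ /=.
  by rewrite exprMn mulrC.
have PD : P`_D != 0.
  suff -> : P`_D = F.[b] by [].
  rewrite coef_sum horner_sum [RHS]big_mkcond; apply: eq_bigr => m _ /=.
  rewrite coefZ coefXn eq_sym; case: ifP => _; last by rewrite mulr0.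
  by rewrite hornerZ hornerXn vE mulr1.
rewrite ltnNge; apply: contra PD => sP; rewrite nth_default //.
by rewrite (leq_trans sP) // /D; lia.
Qed.

(** * Rapidly growing scales *)

(* The second component bounds the sums of s_i y_i over i < j with s_i <= r. *)
Fixpoint scale_pair (D r : nat) (K : int) (j : nat) : int * int :=
  if j is j'.+1 then
    let u := (scale_pair D r K j').2 + r%:Z * (scale_pair D r K j').1 in
    (K * (scale_pair D r K j').1 ^+ D * (u + 1) ^+ D, u)
  else (K, 0).

Definition scale D r K j : int := (scale_pair D r K j).1.
Definition lower_bound D r K j : int := (scale_pair D r K j).2.

Section Scales.
Variables (D r : nat) (K : int).
Hypotheses (D0 : (0 < D)%N) (K1 : 1 <= K).
Local Notation y := (scale D r K).
Local Notation u := (lower_bound D r K).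

Lemma scale0 : y 0%N = K. Proof. by []. Qed.

Lemma scaleS j : y j.+1 = K * y j ^+ D * (u j.+1 + 1) ^+ D.
Proof. by []. Qed.

Lemma lower_boundS j : u j.+1 = u j + r%:Z * y j.
Proof. by []. Qed.

Lemma scale_bounds j : 1 <= y j /\ 0 <= u j.
Proof.
elim: j => [//|j [y1 u0]]; rewrite scaleS.
have u0' : 0 <= u j.+1 by rewrite lower_boundS addr_ge0 // mulr_ge0 //; lia.
split=> //; have := exprn_ege1 D y1.
have : 1 <= (u j.+1 + 1) ^+ D by rewrite exprn_ege1 //; lia.
nia.
Qed.

Lemma scale_ge1 j : 1 <= y j. Proof. by have [] := scale_bounds j. Qed.
Lemma lower_bound_ge0 j : 0 <= u j. Proof. by have [] := scale_bounds j. Qed.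
Hint Resolve scale_ge1 lower_bound_ge0 : core.

(** The factor [(u + 1)^D] of the recursion is there to keep even [D]-th powers of the lower sums
    below [y_j / K]. *)
Lemma scale_ge j : K * (u j + 1) ^+ D <= y j.
Proof.
case: j => [|j]; first by rewrite scale0 add0r expr1n mulr1.
rewrite scaleS mulrAC ler_peMr ?exprn_ege1 //.
have := lower_bound_ge0 j.+1; move: (u j.+1) => v v0.
by rewrite mulr_ge0 ?exprn_ge0 ?addr_ge0 //; lia.
Qed.

Lemma scale_dvdS j : (K * y j ^+ D %| y j.+1)%Z.
Proof. by rewrite scaleS dvdz_mulr. Qed.

Lemma scale_dvd i j : (i <= j)%N -> (y i %| y j)%Z.
Proof.
elim: j => [|j IH]; first by rewrite leqn0 => /eqP->.
rewrite leq_eqVlt => /predU1P[->//|/IH h].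
apply: dvdz_trans h (dvdz_trans _ (scale_dvdS j)).
by rewrite dvdz_mull // -(prednK D0) exprS dvdz_mulr.
Qed.

(** Once [K] is a multiple of [2 c D], later scales are multiples of the periods of the waves built
    from earlier ones. *)
Lemma scale_dvd_lt i j : (i < j)%N -> (K * y i ^+ D %| y j)%Z.
Proof. by move=> ij; apply: dvdz_trans (scale_dvdS i) (scale_dvd ij). Qed.

Lemma dvd_scale j : (K %| y j)%Z.
Proof. exact: (scale_dvd (leq0n j)). Qed.

Variable s : nat -> nat.
Hypothesis s_le : forall j, (s j <= r)%N.

Lemma lower_sum_bound j : 0 <= \sum_(i < j) (s i)%:Z * y i <= u j.
Proof.
elim: j => [|j /andP[IH0 IH]]; first by rewrite big_ord0.
rewrite big_ord_recr /= lower_boundS addr_ge0 ?mulr_ge0 //=; last first.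
  by rewrite (le_trans _ (scale_ge1 j)).
rewrite lerD // ler_wpM2r ?lez_nat //.
by rewrite (le_trans _ (scale_ge1 j)).
Qed.

(** The terms below [j] form a small remainder; those above [j] are absorbed in a multiple of
    [y_(j+1)], harmless by divisibility rather than by size. *)
Lemma sum_split n j : (j < n)%N -> exists q,
  \sum_(i < n) (s i)%:Z * y i =
    (s j)%:Z * y j + \sum_(i < j) (s i)%:Z * y i + y j.+1 * q.
Proof.
elim: n => // n IH; rewrite ltnS leq_eqVlt => /predU1P[->|jn].
  by exists 0; rewrite big_ord_recr mulr0 addr0 addrC.
have [q qE] := IH jn; have /dvdzP[k kE] := scale_dvd jn.
by exists (q + (s n)%:Z * k); rewrite big_ord_recr /= qE kE; ring.
Qed.

End Scales.

(** [P(t)] is a multiple [e] of the half-period up to a fraction [C / K] of it, and only the parity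
    of [e] matters for the wave. For the wave of a single scale, [P(t)] is reduced modulo [y_(j+1)]
    and replaced by its leading term. For the mixed wave it is reduced modulo [y_(j+2)] and expanded
    in [s_(j+1) y_(j+1)] around the sum [w] of the lower terms, where [P'(w)] is close to its
    leading term. [C] comes before [K], so that [K] can be chosen large against it. *)
Lemma poly_scale_near (P : {poly int}) (r : nat) (D := (size P).-1)
    (c := `|lead_coef P| : int) : (2 < size P)%N ->
  exists2 C : int, 1 <= C & forall K : int, 1 <= K -> (2 * c * D%:Z %| K)%Z ->
  forall (s : nat -> nat) (n j : nat), (forall i, (s i <= r)%N) -> (j < n)%N ->
  let y := scale D r K in
  let t := \sum_(i < n) (s i)%:Z * y i in
  (exists e err : int, [/\ P.[t] = c * y j ^+ D * e + err,
      oddz e = odd (s j) & K * `|err| <= C * (c * y j ^+ D)]) /\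
  ((j.+1 < n)%N -> exists e err : int,
    [/\ P.[t] = c * D%:Z * y j ^+ D.-1 * y j.+1 * e + err,
      oddz e = odd (s j) && odd (s j.+1) &
      K * `|err| <= C * (c * D%:Z * y j ^+ D.-1 * y j.+1)]).
Proof.
move=> sP.
have sPD : size P = D.+1 by rewrite /D; lia.
have lcE : lead_coef P = P`_D by [].
have P0 : P != 0 by rewrite -size_poly_gt0; lia.
have c1 : 1 <= c by have := lead_coef_eq0 P; rewrite (negPf P0) /c; lia.
(* The leading coefficient is [c] times 1 or -1; written as [1 + 2 d], this sign visibly leaves
   parities unchanged. *)
have [d dE] : exists d : int, P`_D = c * (1 + 2 * d).
  rewrite -lcE; have [l0|l0] := lerP 0 (lead_coef P).
    by exists 0; rewrite /c ger0_norm //; lia.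
  by exists (-1); rewrite /c ltr0_norm //; lia.
have [n0 DE] : exists n0, D = n0.+2 by exists D.-2; lia.
move: D sPD dE DE {lcE} => D sPD dE DE; subst D.
have [C1 C10 H1] := horner_leading_bound r (eq_leq sPD).
have sP' : (size P^`() <= n0.+2)%N.
  by have := lt_size_deriv P0; rewrite sPD.
have [C2 C20 H2] := horner_leading_bound r sP'.
exists (C1 + r%:Z * C2 + 1); first by rewrite lerDr addr_ge0 // mulr_ge0.
move=> K K1 /dvdzP[k' kE] s n j s_le jn y t.
have y1 i : 1 <= y i by exact: scale_ge1.
have u0 i : 0 <= lower_bound n0.+2 r K i by exact: lower_bound_ge0.
have Ku i : K * (lower_bound n0.+2 r K i + 1) ^+ n0.+2 <= y i by exact: scale_ge.
have wb i : 0 <= \sum_(i0 < i) (s i0)%:Z * y i0 <= lower_bound n0.+2 r K i.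
  by apply: lower_sum_bound.
have split_t i : (i < n)%N -> exists q,
    t = (s i)%:Z * y i + \sum_(i0 < i) (s i0)%:Z * y i0 + y i.+1 * q.
  by apply: sum_split.
have yS i : exists m, y i.+1 = K * y i ^+ n0.+2 * m.
  by exists ((lower_bound n0.+2 r K i.+1 + 1) ^+ n0.+2).
(* Since [w <= u_i] and [K (u_i + 1)^D <= y_i], one factor [y_i] of the leading term estimate is
   traded for [K]. *)
have err_bound E C err i w : 0 <= C -> 0 <= w <= lower_bound n0.+2 r K i ->
    (E <= n0.+2)%N -> `|err| * y i <= C * (w + 1) ^+ E * y i ^+ E -> K * `|err| <= C * y i ^+ E.
  move=> C0 /andP[w0 wu] En h.
  have yi := y1 i.
  rewrite -(ler_pM2r (_ : 0 < y i)); last lia.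
  rewrite -mulrA (le_trans (ler_wpM2l _ h)) //; first lia.
  have -> : K * (C * (w + 1) ^+ E * y i ^+ E) = C * y i ^+ E * (K * (w + 1) ^+ E) by ring.
  rewrite ler_wpM2l // ?mulr_ge0 // ?exprn_ge0 //; first lia.
  apply: le_trans (Ku i); rewrite ler_wpM2l //; first lia.
  rewrite (@le_trans _ _ ((lower_bound n0.+2 r K i + 1) ^+ E)) //.
    by rewrite lerXn2r ?nnegrE ?lerD2r //; have := u0 i; lia.
  by rewrite ler_weXn2l //; have := u0 i; lia.
have odd12 a : oddz ((1 + 2 * d) * a) = oddz a by rewrite oddzM oddzD oddzM.
have oddX (i m : nat) : oddz (i%:Z ^+ m.+1) = odd i.
  by rewrite -rmorphXn oddz_nat; rewrite oddX.
split.
  have [q tE] := split_t _ jn; have [m mE] := yS j.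
  have [k kkE] := horner_subz_dvd P t ((s j)%:Z * y j + \sum_(i0 < j) (s i0)%:Z * y i0).
  set w := \sum_(i0 < j) _ in tE kkE.
  have [w0 wu] := andP (wb j); rewrite -/w in w0 wu.
  have h := H1 w (y j) (s j) w0 (y1 j) (s_le j).
  (* The first summand comes from the leading term and carries the parity; the multiple of [y j.+1]
     contributes an even number because [2 c D] divides [K]. *)
  exists ((1 + 2 * d) * (s j)%:Z ^+ n0.+2 + 2 * (n0.+2%:Z * k' * m * q * k)).
  exists (P.[(s j)%:Z * y j + w] - P`_n0.+2 * (s j)%:Z ^+ n0.+2 * y j ^+ n0.+2).
  split.
  - rewrite kkE dE.
    have -> : t - ((s j)%:Z * y j + w) = y j.+1 * q by rewrite tE; ring.
    by rewrite mE {1}kE; ring.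
  - by rewrite oddzD odd12 oddzM /= addbF oddX.
  - apply: (@le_trans _ _ (C1 * y j ^+ n0.+2)).
      by apply: err_bound h => //; rewrite w0.
    apply: ler_pM => //; first by rewrite exprn_ge0 //; have := y1 j; lia.
      by rewrite -addrA lerDl addr_ge0 // mulr_ge0.
    by rewrite ler_peMl // exprn_ge0 //; have := y1 j; lia.
move=> jn1; have [q tE] := split_t _ jn1.
set w := \sum_(i0 < j.+1) _ in tE.
have [m mE] := yS j; have [m' mE'] := yS j.+1.
have [k kkE] := horner_subz_dvd P t (w + (s j.+1)%:Z * y j.+1).
have [k2 k2E] := horner_taylor2 P w ((s j.+1)%:Z * y j.+1).
have wE : w = (s j)%:Z * y j + \sum_(i0 < j) (s i0)%:Z * y i0.
  by rewrite /w big_ord_recr /= addrC.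
(* With [s = 0] and [y = 1] the estimate reads [|P(w)| <= C1 (w + 1)^D]. *)
have h1 := H1 w 1 0%N; have [w0 wu] := andP (wb j.+1); rewrite -/w in w0 wu.
have {}h1 := h1 w0 (lexx _) (leq0n _).
have [v0 vu] := andP (wb j); have h2 := H2 _ (y j) (s j) v0 (y1 j) (s_le j).
rewrite -wE coef_deriv dE in h2.
have sj1 : (s j.+1)%:Z <= r%:Z by rewrite lez_nat.
set S := (s j.+1)%:Z in sj1 tE kkE k2E *.
have S0 : 0 <= S by [].
set err' := P^`().[w] - _ in h2.
(* The first summand is the leading part of [P'(w) * S * y j.+1]; the second order Taylor remainder
   and the multiple of [y j.+2] contribute even numbers. *)
exists ((1 + 2 * d) * ((s j)%:Z ^+ n0.+1 * S) +
  2 * (k' * S ^+ 2 * y j * m * k2 + k' * m' * m * y j.+1 ^+ n0 * y j * K * q * k)).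
exists (P.[w] + S * y j.+1 * err').
split.
- rewrite kkE k2E.
  have -> : t - (w + S * y j.+1) = y j.+2 * q by rewrite tE; ring.
  have -> : P^`().[w] = (c * (1 + 2 * d) *+ n0.+2 * (s j)%:Z ^+ n0.+1 * y j ^+ n0.+1) + err'.
    by rewrite /err'; ring.
  have -> : y j.+2 = 2 * c * n0.+2%:Z * k' *
      (y j.+1 * y j.+1 ^+ n0 * (K * (y j * y j ^+ n0.+1) * m)) * m'.
    by rewrite -exprS -mE mE' {1}kE !exprS; ring.
  have -> : (S * y j.+1) ^+ 2 = S ^+ 2 * y j.+1 *
      (2 * c * n0.+2%:Z * k' * (y j * y j ^+ n0.+1) * m).
    by rewrite -exprS (_ : 2 * c * n0.+2%:Z * k' = K) -?mE ?kE; ring.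
  rewrite -mulr_natr natz /=; ring.
- by rewrite oddzD odd12 !oddzM /= addbF oddX.
have yj0 : 0 <= y j ^+ n0.+1 by rewrite exprn_ge0 //; have := y1 j; lia.
have yj1 : 0 <= y j.+1 by have := y1 j.+1; lia.
have b1 : K * `|P.[w]| <= C1 * y j.+1.
  rewrite mul0r add0r expr0n /= mulr0 mul0r subr0 mulr1 expr1n mulr1 in h1.
  apply: (@le_trans _ _ (K * (C1 * (w + 1) ^+ n0.+2))).
    by rewrite ler_wpM2l //; lia.
  rewrite mulrCA ler_wpM2l //; apply: le_trans (Ku _).
  by rewrite ler_wpM2l //; [lia|rewrite lerXn2r ?nnegrE ?lerD2r //; lia].
have b2 : K * `|err'| <= C2 * y j ^+ n0.+1.
  by apply: err_bound h2 => //; rewrite v0.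
have b3 : K * `|S * y j.+1 * err'| <= r%:Z * C2 * (y j ^+ n0.+1 * y j.+1).
  rewrite normrM (normrM S) (ger0_norm S0) (ger0_norm yj1).
  have -> : K * (S * y j.+1 * `|err'|) = S * (K * `|err'|) * y j.+1 by ring.
  have -> : r%:Z * C2 * (y j ^+ n0.+1 * y j.+1) = r%:Z * (C2 * y j ^+ n0.+1) * y j.+1 by ring.
  apply: ler_wpM2r => //.
  by apply: ler_pM; rewrite ?mulr_ge0 // (le_trans _ K1).
apply: (@le_trans _ _ (C1 * (y j ^+ n0.+1 * y j.+1) + r%:Z * C2 * (y j ^+ n0.+1 * y j.+1))).
  apply: (@le_trans _ _ (K * `|P.[w]| + K * `|S * y j.+1 * err'|)).
    by rewrite -mulrDr ler_wpM2l ?ler_normD //; lia.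
  apply: lerD => //; apply: (le_trans b1).
  by rewrite ler_wpM2l // ler_peMl // exprn_ege1.
have -> : c * n0.+2%:Z * y j ^+ n0.+1 * y j.+1 = (c * n0.+2%:Z) * (y j ^+ n0.+1 * y j.+1).
  by rewrite mulrA.
have cn1 : 1 <= c * n0.+2%:Z by rewrite -[1]mulr1 ler_pM.
rewrite -mulrDl; apply: ler_pM.
- by rewrite addr_ge0 // mulr_ge0.
- by rewrite mulr_ge0.
- by rewrite lerDl.
- exact: ler_peMl (mulr_ge0 yj0 yj1) cn1.
Qed.

(** * Square waves and means *)

Lemma sum_ord_succ (V : zmodType) (G : int -> V) (H : nat) :
  \sum_(i < H) G (i%:Z + 1) = \sum_(i < H) G i%:Z + G H%:Z - G 0.
Proof.
have -> : \sum_(i < H) G (i%:Z + 1) = \sum_(i < H) G (i.+1)%:Z.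
  by apply: eq_bigr => i _; congr G; rewrite intS addrC.
by rewrite -(big_ord_recr H (fun i => G i%:Z)) big_ord_recl addrC addKr.
Qed.

(** The summand counts the multiples of [l] in []i + a, i + b]]. As [i] runs over [k] full periods,
    each unit step from [a] to [b] is counted [k] times. *)
Lemma sum_floor_diff (l k : int) (H : nat) (a b : int) : 0 < l -> H%:Z = k * l ->
  a <= b -> \sum_(i < H) (((i%:Z + b) %/ l)%Z - ((i%:Z + a) %/ l)%Z) = k * (b - a).
Proof.
move=> l0 Hk ab; have [m bE] : exists m : nat, b = a + m%:Z by exists `|b - a|%N; lia.
rewrite bE {b ab bE}; elim: m => [|m IH].
  by rewrite addr0 subrr mulr0 big1 // => i _; rewrite subrr.
have -> : k * (a + m.+1%:Z - a) = k * (a + m%:Z - a) + k by rewrite intS; ring.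
rewrite -{}IH !sumrB addrAC; congr (_ - _).
pose G z := ((z + (a + m%:Z)) %/ l)%Z.
have := sum_ord_succ G H; rewrite /G => e.
transitivity (\sum_(i < H) ((i%:Z + 1 + (a + m%:Z)) %/ l)%Z).
  by apply: eq_bigr => i _; congr (_ %/ _)%Z; rewrite intS; ring.
rewrite e Hk -addrA; congr (_ + _).
by rewrite divzMDl ?gt_eqF // add0r addrK.
Qed.

(** Booleans stand for signs and exclusive or for their product: this is the product of the square
    waves of half-periods [l]. *)
Definition parity_wave (ls : seq int) (z : int) : bool :=
  \big[addb/false]_(l <- ls) oddz (z %/ l)%Z.

Lemma parity_wave_period ls (H z : int) : {in ls, forall l, 0 < l} ->
  {in ls, forall l, 2 * l %| H}%Z -> parity_wave ls (z + H) = parity_wave ls z.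
Proof.
move=> l0 lH; apply: eq_big_seq => l ls_l.
have /dvdzP[k ->] := lH _ ls_l.
rewrite (_ : k * (2 * l) = k * 2 * l); last by ring.
by rewrite divzDr ?dvdz_mull // mulzK ?gt_eqF ?l0 // oddzD oddzM andbF addbF.
Qed.

Lemma divz_between (l a b z : int) : 0 < l -> a <= z <= b ->
  (a %/ l)%Z = (b %/ l)%Z -> (z %/ l)%Z = (a %/ l)%Z.
Proof.
move=> l0 /andP[az zb] ab; have le := lez_pdiv2r (ltW l0).
by apply/eqP; rewrite eq_le {1}ab !le.
Qed.

Definition local (L : nat) (T : Type) (G : (int -> bool) -> T) : Prop :=
  forall f g, (forall z : int, - L%:Z <= z < L%:Z -> f z = g z) -> G f = G g.

Section Averages.
Variable R : realFieldType.

Definition avg (n : nat) (F : nat -> R) : R := n%:R^-1 * \sum_(i < n) F i.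

Lemma avg_lin n a F G : avg n (fun i => a * F i + G i) = a * avg n F + avg n G.
Proof. by rewrite /avg big_split /= mulrDr -mulr_sumr mulrCA. Qed.

Lemma avgD n F G : avg n (fun i => F i + G i) = avg n F + avg n G.
Proof. by rewrite /avg big_split mulrDr. Qed.

Lemma avg_const n a : (0 < n)%N -> avg n (fun _ => a) = a.
Proof.
by move=> n0; rewrite /avg sumr_const card_ord -[a *+ n]mulr_natl mulKf // pnatr_eq0 -lt0n.
Qed.

Lemma ler_avg n F G : (forall i, (i < n)%N -> F i <= G i) -> avg n F <= avg n G.
Proof.
by move=> FG; rewrite ler_wpM2l ?invr_ge0 //; apply: ler_sum => i _; apply: FG.
Qed.

Lemma eq_avg n F G : (forall i, (i < n)%N -> F i = G i) -> avg n F = avg n G.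
Proof. by move=> FG; rewrite /avg; congr (_ * _); apply: eq_bigr => i _; apply: FG. Qed.

Lemma avg_ge0 n F : (forall i, 0 <= F i) -> 0 <= avg n F.
Proof. by move=> F0; rewrite mulr_ge0 ?invr_ge0 // sumr_ge0. Qed.

Lemma ler_norm_avg n F : `|avg n F| <= avg n (fun i => `|F i|).
Proof.
by rewrite normrM ger0_norm ?invr_ge0 // ler_wpM2l ?invr_ge0 // ler_norm_sum.
Qed.

Lemma avgB_const n F a : (0 < n)%N -> avg n F - a = avg n (fun i => F i - a).
Proof.
move=> n0; rewrite -{1}(avg_const a n0) /avg -mulrBr; congr (_ * _).
by rewrite -sumrB.
Qed.

Lemma avg_sum (I : Type) (s : seq I) n (F : nat -> I -> R) :
  avg n (fun i => \sum_(j <- s) F i j) = \sum_(j <- s) avg n (F^~ j).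
Proof. by rewrite /avg exchange_big /= mulr_sumr. Qed.

(** The mean number of multiples of [l] in an interval with random position; the probabilities of
    meeting a block or wave boundary are all bounded by such means. *)
Lemma avg_floor_diff (l a b : int) (H : nat) : (0 < H)%N -> 0 < l -> (l %| H%:Z)%Z ->
  a <= b ->
  avg H (fun i => (((i%:Z + b) %/ l)%Z - ((i%:Z + a) %/ l)%Z)%:~R) = (b - a)%:~R / l%:~R.
Proof.
move=> H0 l0 /dvdzP[k Hk] ab.
rewrite /avg -(rmorph_sum (@intmul R 1)) /= (sum_floor_diff l0 Hk ab).
rewrite -[H%:R]/(H%:Z%:~R) Hk !intrM.
have k0 : k != 0 by apply: contraTneq H0 => k0; move: Hk; rewrite k0 mul0r; lia.
by field; rewrite !intr_eq0 k0 gt_eqF.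
Qed.

(* The expectation of a stationary process invariant under negation.  Only
   finite averages of evaluations occur, so no measurability is needed. *)
Record mean := Mean {
  ev :> ((int -> bool) -> R) -> R ;
  ev_lin : forall a F G, ev (fun f => a * F f + G f) = a * ev F + ev G ;
  ev_ge0 : forall F, (forall f, 0 <= F f) -> 0 <= ev F ;
  ev1 : ev (fun=> 1) = 1 ;
  ev_shift1 : forall F, ev (fun f => F (fun z => f (z + 1))) = ev F ;
  ev_flip : forall F, ev (fun f => F (fun z => ~~ f z)) = ev F }.

Section MeanTheory.
Variable E : mean.

Lemma eq_ev F G : F =1 G -> E F = E G.
Proof. by move=> /funext ->. Qed.

Lemma ev0 : E (fun=> 0) = 0.
Proof.
have e : E (fun=> 0) = 1 * E (fun=> 0) + E (fun=> 0).
  by rewrite -ev_lin; apply: eq_ev => f; rewrite mul1r addr0.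
lra.
Qed.

Lemma evD F G : E (fun f => F f + G f) = E F + E G.
Proof. by rewrite -[E F]mul1r -ev_lin; apply: eq_ev => f; rewrite mul1r. Qed.

Lemma evZ a F : E (fun f => a * F f) = a * E F.
Proof.
rewrite -[RHS]addr0 -[X in _ + X]ev0 -ev_lin.
by apply: eq_ev => f; rewrite addr0.
Qed.

Lemma evZr a F : E (fun f => F f * a) = E F * a.
Proof. by rewrite mulrC -evZ; apply: eq_ev => f; rewrite mulrC. Qed.

Lemma ev_const a : E (fun=> a) = a.
Proof. by rewrite -[RHS]mulr1 -(ev1 E) -evZ; apply: eq_ev => f; rewrite mulr1. Qed.

Lemma evB F G : E (fun f => F f - G f) = E F - E G.
Proof.
rewrite -mulN1r addrC -ev_lin.
by apply: eq_ev => f; rewrite mulN1r addrC.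
Qed.

Lemma ler_ev F G : (forall f, F f <= G f) -> E F <= E G.
Proof. by move=> FG; rewrite -subr_ge0 -evB ev_ge0 // => f; rewrite subr_ge0. Qed.

Lemma ev_itv F : (forall f, 0 <= F f <= 1) -> 0 <= E F <= 1.
Proof.
move=> h; rewrite ev_ge0; last by move=> f; have /andP[] := h f.
by rewrite -(ev1 E); apply: ler_ev => f; have /andP[] := h f.
Qed.

Lemma ev_shift (m : int) F : E (fun f => F (fun z => f (z + m))) = E F.
Proof.
have nat_case (n : nat) G : E (fun f => G (fun z => f (z + n%:Z))) = E G.
  elim: n G => [|n IH] G; first by apply: eq_ev => f; congr G; apply/funext => z; rewrite addr0.
  rewrite -(IH G) -(ev_shift1 E (fun f => G (fun z => f (z + n%:Z)))).
  by apply: eq_ev => f; congr G; apply/funext => z; rewrite intS; congr f; lia.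
case: m => [n|n]; first exact: nat_case.
rewrite -(nat_case n.+1); apply: eq_ev => f; congr F; apply/funext => z.
by congr f; lia.
Qed.

Lemma ev_twist (m : int) (e : bool) F :
  E (fun f => F (fun z => f (z + m) (+) e)) = E F.
Proof.
rewrite (ev_shift m (fun f => F (fun z => f z (+) e))); case: e.
  by rewrite -[RHS]ev_flip; apply: eq_ev => f; congr F; apply/funext => z; rewrite addbT.
by apply: eq_ev => f; congr F; apply/funext => z; rewrite addbF.
Qed.

End MeanTheory.

(** * One stage: two independent blocks, repeated periodically and multiplied by a slow wave *)

Section Stage.
Variables (E : mean) (L N n H : nat) (ls : nat -> seq int).
Hypotheses (n_gt0 : (0 < n)%N) (H_gt0 : (0 < H)%N) (N_gt0 : (0 < N)%N).
Hypothesis ls_gt0 : forall q, {in ls q, forall l, 0 < l}.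
Hypothesis ls_dvd : forall q, {in ls q, forall l, 2 * l %| H%:Z}%Z.
Hypothesis N_dvd : (2 * N%:Z %| H%:Z)%Z.

Definition two_blocks (b1 b2 : int -> bool) (z : int) : bool :=
  (if oddz (z %/ N%:Z)%Z then b2 else b1) (z %% N%:Z)%Z.

Definition staged (q : nat) (x : int) (b1 b2 : int -> bool) : int -> bool :=
  fun z => two_blocks b1 b2 (z + x) (+) parity_wave (ls q) (z + x).

(** The wave [q] and the phase [x] are uniform, [x] modulo the common period [H]; the iterated
    expectation makes [b1] and [b2] independent copies of the old process. *)
Definition stage_ev (F : (int -> bool) -> R) : R :=
  avg n (fun q => avg H (fun x =>
    E (fun b1 => E (fun b2 => F (staged q x%:Z b1 b2))))).

Lemma two_blocks_period b1 b2 (m z : int) : (2 * N%:Z %| m)%Z ->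
  two_blocks b1 b2 (z + m) = two_blocks b1 b2 z.
Proof.
move=> /dvdzP[k ->]; have -> : k * (2 * N%:Z) = k * 2 * N%:Z by ring.
have N0 : N%:Z != 0 by lia.
rewrite /two_blocks divzDr ?dvdz_mull // mulzK // oddzD oddzM andbF addbF.
by rewrite addrC modzMDl.
Qed.

Lemma staged_period q x b1 b2 : staged q (x + H%:Z) b1 b2 = staged q x b1 b2.
Proof.
apply/funext => z; rewrite /staged addrA (two_blocks_period _ _ _ N_dvd).
by rewrite (parity_wave_period _ (@ls_gt0 q) (@ls_dvd q)).
Qed.

Fact stage_lin a F G :
  stage_ev (fun f => a * F f + G f) = a * stage_ev F + stage_ev G.
Proof.
rewrite /stage_ev -avg_lin; apply: eq_avg => q _; rewrite -avg_lin.
apply: eq_avg => x _; rewrite -ev_lin; apply: eq_ev => b1.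
by rewrite -ev_lin.
Qed.

Fact stage_ge0 F : (forall f, 0 <= F f) -> 0 <= stage_ev F.
Proof.
move=> F0; do 2! apply: avg_ge0 => ?.
by apply: ev_ge0 => b1; apply: ev_ge0 => b2; apply: F0.
Qed.

Fact stage1 : stage_ev (fun=> 1) = 1.
Proof.
rewrite -[RHS](avg_const 1 n_gt0); apply: eq_avg => q _.
rewrite -[RHS](avg_const 1 H_gt0); apply: eq_avg => x _.
by rewrite !ev_const.
Qed.

(** A shift by 1 adds 1 to the phase, and the phases 0 and [H] give the same path. *)
Fact stage_shift1 F : stage_ev (fun f => F (fun z => f (z + 1))) = stage_ev F.
Proof.
apply: eq_avg => q _; rewrite /avg; congr (_ * _).
pose G x := E (fun b1 => E (fun b2 => F (staged q x b1 b2))).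
have GH : G H%:Z = G 0.
  by apply: eq_ev => b1; apply: eq_ev => b2; rewrite -[H%:Z]add0r staged_period.
have := sum_ord_succ G H; rewrite GH addrK => <-.
apply: eq_bigr => x _; apply: eq_ev => b1; apply: eq_ev => b2.
by congr F; apply/funext => z; rewrite /staged -addrA (addrC 1).
Qed.

Fact stage_flip F : stage_ev (fun f => F (fun z => ~~ f z)) = stage_ev F.
Proof.
apply: eq_avg => q _; apply: eq_avg => x _.
rewrite -(ev_flip E); apply: eq_ev => b1; rewrite -(ev_flip E); apply: eq_ev => b2.
congr F; apply/funext => z; rewrite /staged /two_blocks.
by case: oddz; rewrite -addNb negbK.
Qed.

Definition stage : mean :=
  Mean stage_lin stage_ge0 stage1 stage_shift1 stage_flip.


(* If this vanishes, then near [x] and [x + N] the sequence [staged q x b1 b2]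
   reads translates of b1 and of b2, up to a common sign. *)
Definition boundary_count (q : nat) (x : int) : int :=
  ((x + L%:Z) %/ N%:Z)%Z - ((x - L%:Z) %/ N%:Z)%Z +
  \sum_(l <- ls q) (((x + (N + L)%:Z) %/ l)%Z - ((x - L%:Z) %/ l)%Z).

Lemma boundary_terms_ge0 q (x : int) :
  0 <= ((x + L%:Z) %/ N%:Z)%Z - ((x - L%:Z) %/ N%:Z)%Z /\
  {in ls q, forall l, 0 <= ((x + (N + L)%:Z) %/ l)%Z - ((x - L%:Z) %/ l)%Z}.
Proof.
split=> [|l lq]; rewrite subr_ge0 lez_pdiv2r //; try lia.
exact/ltW/(ls_gt0 lq).
Qed.

Lemma parity_wave_const q (x : int) :
  \sum_(l <- ls q) (((x + (N + L)%:Z) %/ l)%Z - ((x - L%:Z) %/ l)%Z) = 0 ->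
  forall z, x - L%:Z <= z <= x + (N + L)%:Z -> parity_wave (ls q) z = parity_wave (ls q) x.
Proof.
have [_ h] := boundary_terms_ge0 q x; rewrite big_seq => /eqP.
rewrite psumr_eq0 // => /allP s0 z zx; apply: eq_big_seq => l lq; congr oddz.
have /eqP : ((x + (N + L)%:Z) %/ l)%Z - ((x - L%:Z) %/ l)%Z == 0.
  by have := s0 _ lq; rewrite lq.
move=> /eqP; rewrite subr_eq0 => /eqP/esym e.
rewrite (divz_between (ls_gt0 lq) zx e) (divz_between (ls_gt0 lq) _ e) //; lia.
Qed.

Lemma staged_good q (x : int) : boundary_count q x = 0 ->
  exists (m : int) (s e : bool), forall b1 b2 (z : int), - L%:Z <= z < L%:Z ->
    staged q x b1 b2 z = (if s then b2 else b1) (z + m) (+) e /\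
    staged q x b1 b2 (z + N%:Z) = (if s then b1 else b2) (z + m) (+) e.
Proof.
have [h0 h] := boundary_terms_ge0 q x; rewrite /boundary_count => /eqP.
rewrite paddr_eq0 //; last by rewrite big_seq sumr_ge0.
move=> /andP[/eqP/eqP]; rewrite subr_eq0 => /eqP/esym eN /eqP/parity_wave_const wx.
have N0 : 0 < N%:Z by lia.
have Nz : N%:Z != 0 by lia.
(* The position of [x] inside its block, the block that contains it, and the sign of the wave, which
   is constant on the whole stretch. *)
exists (x - (x %/ N%:Z)%Z * N%:Z), (oddz (x %/ N%:Z)%Z), (parity_wave (ls q) x).
move=> b1 b2 z zL.
have zx : ((z + x) %/ N%:Z)%Z = (x %/ N%:Z)%Z.
  by rewrite (divz_between N0 _ eN) ?(divz_between N0 _ eN) //; lia.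
have zE : ((z + x) %% N%:Z)%Z = z + (x - (x %/ N%:Z)%Z * N%:Z).
  by have := divz_eq (z + x) N%:Z; rewrite zx; lia.
split; rewrite /staged wx; try lia.
  by rewrite /two_blocks zx zE.
rewrite /two_blocks addrAC modzDr zE divzDr // divzz Nz zx oddzD.
by case: oddz.
Qed.

(** At phases without boundaries the two events read different blocks, which are independent, and
    invariance under translation and negation removes [m] and [e]; the expectation is then the
    product. At the other phases the error is at most 1, hence at most the boundary count, whose
    mean is the right-hand side. *)
Lemma stage_mix (G1 G2 : (int -> bool) -> bool) : local L G1 -> local L G2 ->
  `|stage (fun f => (G1 f && G2 (fun z => f (z + N%:Z)))%:R)
     - E (fun f => (G1 f)%:R) * E (fun f => (G2 f)%:R)|
  <= (2 * L)%:R / N%:R + avg n (fun q => \sum_(l <- ls q) (N + 2 * L)%:R / l%:~R).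
Proof.
move=> G1L G2L; set c1 := E _; set c2 := E (fun f => (G2 f)%:R).
have itv01 (b : bool) : 0 <= (b%:R : R) <= 1 by case: b; rewrite ?lexx ler01.
have c1_itv : 0 <= c1 <= 1 by apply: ev_itv.
have c2_itv : 0 <= c2 <= 1 by apply: ev_itv.
have c_itv : 0 <= c1 * c2 <= 1 by nra.
apply: (@le_trans _ _ (avg n (fun q => avg H (fun x => (boundary_count q x%:Z)%:~R)))).
  rewrite /stage /= /stage_ev avgB_const //.
  apply: (le_trans (ler_norm_avg _ _)); apply: ler_avg => q _.
  rewrite avgB_const //; apply: (le_trans (ler_norm_avg _ _)); apply: ler_avg => x _.
  have [h0 h] := boundary_terms_ge0 q x%:Z.
  have : 0 <= boundary_count q x%:Z by rewrite addr_ge0 // big_seq sumr_ge0.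
  rewrite le_eqVlt => /predU1P[/esym bc|bc].
    have [m [s [e st]]] := staged_good bc.
    suff -> : E (fun b1 => E (fun b2 => (G1 (staged q x%:Z b1 b2) &&
       G2 (fun z => staged q x%:Z b1 b2 (z + N%:Z)))%:R)) = c1 * c2.
      by rewrite subrr normr0 bc.
    have -> : (fun b1 => E (fun b2 => (G1 (staged q x%:Z b1 b2) &&
        G2 (fun z => staged q x%:Z b1 b2 (z + N%:Z)))%:R)) =
      (fun b1 => E (fun b2 =>
        (G1 (fun z => (if s then b2 else b1) (z + m) (+) e))%:R *
        (G2 (fun z => (if s then b1 else b2) (z + m) (+) e))%:R)).
      apply/funext => b1; apply: eq_ev => b2; rewrite -natrM mulnb.
      congr ((_ && _)%:R); [apply: G1L|apply: G2L] => z zL.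
        by have [] := st b1 b2 z zL.
      by have [] := st b1 b2 z zL.
    have tw (G : (int -> bool) -> bool) :
        E (fun b => (G (fun z => b (z + m) (+) e))%:R) = E (fun f => (G f)%:R).
      exact: (ev_twist E m e (fun f => (G f)%:R)).
    case: (s).
      transitivity (E (fun b1 => c1 * (G2 (fun z => b1 (z + m) (+) e))%:R)).
        by apply: eq_ev => b1 /=;
          rewrite (evZr E _ (fun b => (G1 (fun z => b (z + m) (+) e))%:R)) tw.
      by rewrite (evZ E _ (fun b => (G2 (fun z => b (z + m) (+) e))%:R)) tw.
    transitivity (E (fun b1 => (G1 (fun z => b1 (z + m) (+) e))%:R * c2)).
      by apply: eq_ev => b1 /=; rewrite (evZ E _ (fun b => (G2 (fun z => b (z + m) (+) e))%:R)) tw.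
    by rewrite (evZr E _ (fun b => (G1 (fun z => b (z + m) (+) e))%:R)) tw.
  have : 0 <= E (fun b1 => E (fun b2 => (G1 (staged q x%:Z b1 b2) &&
       G2 (fun z => staged q x%:Z b1 b2 (z + N%:Z)))%:R)) <= 1.
    by apply: ev_itv => b1; apply: ev_itv.
  set v := E _ => v_itv.
  apply: (@le_trans _ _ 1); first by rewrite ler_norml; lra.
  by rewrite (ler_int R 1).
have N0 : 0 < N%:Z by lia.
rewrite -(avg_const ((2 * L)%:R / N%:R) n_gt0) -avgD.
apply: ler_avg => q _.
have -> : avg H (fun x => (boundary_count q x%:Z)%:~R) = avg H (fun x =>
    (((x%:Z + L%:Z) %/ N%:Z)%Z - ((x%:Z - L%:Z) %/ N%:Z)%Z)%:~R +
    \sum_(l <- ls q)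
      (((x%:Z + (N + L)%:Z) %/ l)%Z - ((x%:Z - L%:Z) %/ l)%Z)%:~R) :> R.
  apply: eq_avg => x _; rewrite /boundary_count intrD; congr (_ + _).
  by rewrite (rmorph_sum (@intmul R 1)).
rewrite avgD avg_sum avg_floor_diff //; [|by rewrite (dvdz_trans _ N_dvd) ?dvdz_mull|lia].
apply: lerD.
  by rewrite opprK -PoszD addnn -mul2n.
rewrite big_seq [leRHS]big_seq; apply: ler_sum => l lq.
rewrite avg_floor_diff ?(ls_gt0 lq) //; last lia; last first.
  by rewrite (dvdz_trans _ (ls_dvd lq)) ?dvdz_mull.
by rewrite opprK -PoszD -addnA addnn mul2n.
Qed.

(** Translation by a multiple of the block period leaves the blocks unchanged, so the waves alone
    decide. *)
Lemma stage_return (m : int) : (2 * N%:Z %| m)%Z ->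
  stage (fun f => (f 0 == f m)%:R) =
  avg n (fun q => avg H (fun x =>
    (parity_wave (ls q) x%:Z == parity_wave (ls q) (x%:Z + m))%:R)).
Proof.
move=> Nm; apply: eq_avg => q _; apply: eq_avg => x _.
set b := (_ == _ in RHS); rewrite -[RHS](ev_const E); apply: eq_ev => b1.
rewrite -[RHS](ev_const E); apply: eq_ev => b2; rewrite /b /staged add0r addrC.
rewrite (two_blocks_period _ _ _ Nm) addrC.
by case: two_blocks; case: parity_wave; case: parity_wave.
Qed.

End Stage.

(** Since [(x + m) %/ l = e + (x + err) %/ l], a wave changes by the parity of [e] unless a multiple
    of [l] separates [x] from [x + err]; this exception has probability at most [|err| / l]. *)
Lemma parity_wave_shift (I : eqType) (s : seq I) (l e err : I -> int) (m : int) (H : nat) :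
  (0 < H)%N -> {in s, forall i, 0 < l i} -> {in s, forall i, l i %| H%:Z}%Z ->
  {in s, forall i, m = l i * e i + err i} ->
  avg H (fun x => (parity_wave [seq l i | i <- s] x%:Z ==
                   parity_wave [seq l i | i <- s] (x%:Z + m))%:R)
  <= (~~ \big[addb/false]_(i <- s) oddz (e i))%:R
     + \sum_(i <- s) `|err i|%:~R / (l i)%:~R :> R.
Proof.
move=> H0 l0 lH lm; set b := (\big[_/_]_(_ <- _) _).
pose lo i := Num.min 0 (err i); pose hi i := Num.max 0 (err i).
have lohi i : lo i <= hi i by rewrite /lo /hi; lia.
have hilo i : hi i - lo i = `|err i| by rewrite /lo /hi; lia.
pose defect (x : nat) i := ((x%:Z + hi i) %/ l i)%Z - ((x%:Z + lo i) %/ l i)%Z.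
have defect_ge0 x i : i \in s -> 0 <= defect x i.
  by move=> /l0 li0; rewrite subr_ge0; apply: lez_pdiv2r; [exact: ltW|rewrite lerD2l].
apply: (@le_trans _ _ (avg H (fun x => (~~ b)%:R + \sum_(i <- s) (defect x i)%:~R))); last first.
  rewrite avgD avg_const // lerD2l avg_sum big_seq [leRHS]big_seq ler_sum // => i si.
  by rewrite avg_floor_diff ?l0 ?lH // hilo.
apply: ler_avg => x _.
have : 0 <= \sum_(i <- s) defect x i by rewrite big_seq sumr_ge0 // => i; apply: defect_ge0.
rewrite -(rmorph_sum (@intmul R 1)) /= le_eqVlt => /predU1P[/esym/eqP|s1]; last first.
  apply: (@le_trans _ _ 1); first by case: (_ == _).
  by apply: (@le_trans _ _ (\sum_(i <- s) defect x i)%:~R); [rewrite (ler_int R 1)|rewrite lerDr].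
rewrite big_seq psumr_eq0; last by move=> i; apply: defect_ge0.
move=> /allP d0.
suff -> : parity_wave [seq l i | i <- s] (x%:Z + m) =
          parity_wave [seq l i | i <- s] x%:Z (+) b.
  apply: (@le_trans _ _ (~~ b)%:R); first by case: parity_wave; case: (b).
  by rewrite lerDl ler0z sumr_ge0 // => i; apply: defect_ge0.
rewrite /parity_wave /b !big_map -big_split; apply: eq_big_seq => i si /=.
have li0 := l0 _ si.
have /eqP : defect x i == 0 by have := d0 _ si; rewrite si.
move=> /eqP; rewrite subr_eq0 => /eqP/esym eq_d.
have between z : lo i <= z <= hi i -> ((x%:Z + z) %/ l i)%Z = ((x%:Z + lo i) %/ l i)%Z.
  by move=> zb; apply: (divz_between li0 _ eq_d); lia.
rewrite {1}(lm _ si) addrCA mulrC divzMDl ?gt_eqF // oddzD addbC; congr (_ (+) _).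
rewrite between; last by rewrite /lo /hi; lia.
by rewrite -[in RHS](addr0 x%:Z) between // /lo /hi; lia.
Qed.

End Averages.

(** * Digits and parities of the partial sums *)

(** With digits at most 1 the terms below [n] sum to less than the scale [n], so equal sums have
    equal top digits. The generators of the IP set are told apart in this way. *)
Lemma scale_digits_inj (D r : nat) (K : int) (s s' : nat -> nat) (n : nat) :
  (0 < D)%N -> 1 <= K -> (0 < r)%N ->
  (forall j, (s j <= 1)%N) -> (forall j, (s' j <= 1)%N) ->
  \sum_(j < n) (s j)%:Z * scale D r K j = \sum_(j < n) (s' j)%:Z * scale D r K j ->
  forall j, (j < n)%N -> s j = s' j.
Proof.
move=> D0 K1 r0 s1 s1'; elim: n => // n IH; rewrite !big_ord_recr /= => e.
have sum_lt (w : nat -> nat) : (forall j, (w j <= 1)%N) ->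
    0 <= \sum_(j < n) (w j)%:Z * scale D r K j < scale D r K n.
  move=> w1; have wr j : (w j <= r)%N by rewrite (leq_trans (w1 j)).
  have /andP[-> h] /= := lower_sum_bound D0 K1 wr n.
  have := scale_ge r D0 K1 n; have u0 := lower_bound_ge0 r D0 K1 n.
  have : lower_bound D r K n + 1 <= (lower_bound D r K n + 1) ^+ D.
    by rewrite ler_eXnr //; lia.
  move=> uV KV; apply: le_lt_trans h _; apply: lt_le_trans KV.
  apply: (@lt_le_trans _ _ ((lower_bound D r K n + 1) ^+ D)); first lia.
  by rewrite ler_peMl // exprn_ge0 // addr_ge0.
have en : s n = s' n.
  move: (sum_lt _ s1) (sum_lt _ s1') e (s1 n) (s1' n).
  move: (\sum_(i < n) (s i)%:Z * _) (\sum_(i < n) (s' i)%:Z * _) => A B hA hB.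
  by case: (s n) => [|[|]] //; case: (s' n) => [|[|]] //; rewrite ?mul0r ?mul1r; lia.
move=> j; rewrite ltnS leq_eqVlt => /predU1P[->//|]; apply: IH.
by apply: (addIr ((s n)%:Z * scale D r K n)); rewrite {2}en.
Qed.

(** Toggling in [S] a fixed element of [J] is an involution that changes the parity of the
    intersection. *)
Lemma sum_even_meet (R : realFieldType) (r : nat) (J : {set 'I_r}) : J != finset.set0 ->
  \sum_(S : {set 'I_r}) (~~ odd #|J :&: S|)%:R = #|{set 'I_r}|%:R / 2 :> R.
Proof.
move=> /set0Pn[i0 i0J].
pose flip (S : {set 'I_r}) := if i0 \in S then (S :\ i0)%SET else (i0 |: S)%SET.
have flipK : involutive flip.
  move=> S; rewrite /flip; case: (boolP (i0 \in S)) => iS.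
    by rewrite finset.in_setD1 eqxx /= finset.setD1K.
  by rewrite finset.in_setU1 eqxx /= finset.setU1K.
have odd_flip S : odd #|J :&: flip S| = ~~ odd #|J :&: S|.
  have step (T : {set 'I_r}) : i0 \in T -> odd #|J :&: (T :\ i0)| = ~~ odd #|J :&: T|.
    move=> iT; rewrite (cardsD1 i0 (J :&: T)) finset.in_setI i0J iT finset.setIDA.
    by rewrite oddS negbK.
  rewrite /flip; case: ifPn => iS; first exact: step.
  by rewrite -[in RHS](finset.setU1K iS) step ?negbK // finset.in_setU1 eqxx.
have e : \sum_(S : {set 'I_r}) (~~ odd #|J :&: S|)%:R =
         \sum_(S : {set 'I_r}) (odd #|J :&: S|)%:R :> R.
  rewrite (reindex_inj (inv_inj flipK)); apply: eq_bigr => S _.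
  by rewrite odd_flip negbK.
have : \sum_(S : {set 'I_r}) (~~ odd #|J :&: S|)%:R +
       \sum_(S : {set 'I_r}) (odd #|J :&: S|)%:R = #|{set 'I_r}|%:R :> R.
  rewrite -big_split /= -sum1_card natr_sum; apply: eq_bigr => S _.
  by case: odd; rewrite ?addr0 ?add0r.
by rewrite -e; lra.
Qed.

Section SubsetPairs.
Variable r : nat.

Definition subset_pair (q : nat) : {set 'I_r} * {set 'I_r} :=
  nth (finset.set0, finset.set0) (enum {: {set 'I_r} * {set 'I_r}}) q.

Definition nb_pairs := #|{: {set 'I_r} * {set 'I_r}}|.

(** The pairs are strung into one sequence: pair [q] governs the scales [2q] and [2q + 1]. *)
Definition subset_at (j : nat) : {set 'I_r} :=
  if odd j then (subset_pair j./2).2 else (subset_pair j./2).1.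

Lemma subset_at_double q : subset_at q.*2 = (subset_pair q).1.
Proof. by rewrite /subset_at odd_double doubleK. Qed.

Lemma subset_at_doubleS q : subset_at q.*2.+1 = (subset_pair q).2.
Proof. by rewrite /subset_at /= odd_double uphalf_double. Qed.

Lemma nb_pairs_gt0 : (0 < nb_pairs)%N.
Proof. by apply/card_gt0P; exists (finset.set0, finset.set0). Qed.

(** At such a scale only generator [i] has digit 1, which separates it from all others. *)
Lemma subset_at_set1 (i : 'I_r) : exists2 j, (j < nb_pairs.*2)%N & subset_at j = [set i]%SET.
Proof.
pose q := index ([set i]%SET, finset.set0) (enum {: {set 'I_r} * {set 'I_r}}).
have qn : (q < nb_pairs)%N by rewrite /nb_pairs cardE index_mem mem_enum.
exists q.*2; first by rewrite ltn_double.
by rewrite subset_at_double /subset_pair nth_index // mem_enum.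
Qed.

(** The sum [s + s s' + s'] is even exactly when [s] and [s'] both are, so this is the proportion of
    waves that keep their sign; each component contributes a factor 1/2. *)
Lemma avg_subset_pairs (R : realFieldType) (J : {set 'I_r}) : J != finset.set0 ->
  avg nb_pairs (fun q => (~~ odd #|J :&: (subset_pair q).1| &&
                          ~~ odd #|J :&: (subset_pair q).2|)%:R) = 1 / 4 :> R.
Proof.
move=> J0; pose g (S : {set 'I_r} * {set 'I_r}) : R :=
  (~~ odd #|J :&: S.1| && ~~ odd #|J :&: S.2|)%:R.
have -> : avg nb_pairs (fun q => (~~ odd #|J :&: (subset_pair q).1| &&
    ~~ odd #|J :&: (subset_pair q).2|)%:R) = nb_pairs%:R^-1 * \sum_S g S :> R.
  congr (_ * _); rewrite -[in RHS]big_enum (big_nth (finset.set0, finset.set0)).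
  by rewrite big_mkord /nb_pairs cardE.
have -> : \sum_S g S = (#|{set 'I_r}|%:R / 2) ^+ 2 :> R.
  rewrite expr2 -{1 2}(sum_even_meet R J0) mulr_suml.
  rewrite -(pair_big xpredT xpredT (fun S1 S2 => g (S1, S2))) /=.
  apply: eq_bigr => S1 _; rewrite mulr_sumr; apply: eq_bigr => S2 _.
  by rewrite /g -natrM mulnb.
have c0 : #|{set 'I_r}|%:R != 0 :> R.
  by rewrite pnatr_eq0 -lt0n; apply/card_gt0P; exists finset.set0.
rewrite /nb_pairs card_prod natrM; field; exact: c0.
Qed.

End SubsetPairs.

(** * A stage with small return probabilities along an IP_r set *)

(* [G2] may be constant, so the mixing clause also says that
   E' is close to E on events of the window [-L, L[. *)
Definition stage_spec (R : realType) (d : nat) (p : mpoly d int) (r : nat) (eps : R)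
    (E E' : mean R) (L L' N : nat) : Prop :=
  [/\ (L + N <= L')%N, (L < L')%N,
    forall G1 G2 : (int -> bool) -> bool, local L G1 -> local L G2 ->
      `|E' (fun f => (G1 f && G2 (fun z => f (z + N%:Z)))%:R)
        - E (fun f => (G1 f)%:R) * E (fun f => (G2 f)%:R)| <= eps &
    exists2 n : 'I_r -> 'rV[int]_d, injective n &
      forall J : {set 'I_r}, J != finset.set0 ->
        let m := eval_at p (\sum_(j in J) n j) in
        (`|m| < L')%N /\ E' (fun f => (f 0 == f m)%:R) <= 1 / 4 + eps].

(** The parameters are chosen in the order [M], [N], [K]: [1 / M] is the precision, [N] makes the
    window short against a block, and [K] makes a block short against every wave. *)
Lemma stage_exists (R : realType) (d : nat) (p : mpoly d int) (E : mean R) (L r : nat)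
    (eps : R) : (2 < msize p)%N -> mcoeff mnm0 p = 0 -> 0 < eps ->
  exists (E' : mean R) (N L' : nat), stage_spec p r eps E E' L L' N.
Proof.
move=> sp p0 eps0.
have [v [P [sP PE]]] := mpoly_line_reduction sp.
have [C C1 near] := poly_scale_near r sP.
set D := (size P).-1 in near; set c : int := `|lead_coef P| in near.
have D0 : (0 < D)%N by rewrite /D; lia.
have c1 : 1 <= c.
  have : lead_coef P != 0 by rewrite lead_coef_eq0 -size_poly_gt0; lia.
  rewrite /c; lia.
have P00 : P.[0] = 0.
  rewrite PE (@meval_eq _ _ _ (fun=> 0)) => [|i]; last by rewrite mul0r.
  rewrite mevalE big_seq big1 // => m mp.
  have [m0|/eqP] := eqVneq m mnm0; first by rewrite m0 p0 mul0r.
  move=> /eqP; rewrite -mdeg_eq0 mdegE sum_nat_eq0 => /forallPn[i /= mi].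
  by rewrite (bigD1 i) //= expr0n (negPf mi) mul0r mulr0.
have [M M0 M_eps] : exists2 M : nat, (0 < M)%N & M%:R^-1 <= eps / 8.
  exists (Num.truncn (8 / eps)).+1 => //.
  rewrite -[eps / 8]invrK lef_pV2 ?posrE ?invr_gt0 ?divr_gt0 // invf_div.
  exact/ltW/truncnS_gt.
have [N N0 NLM] : exists2 N : nat, (0 < N)%N & (2 * L * M <= N)%N.
  by exists (2 * L * M).+1.
have ge1M (a b : int) : 1 <= a -> 1 <= b -> 1 <= a * b by nia.
have D1 : 1 <= D%:Z by [].
have MZ1 : 1 <= M%:Z by [].
have NZ1 : 1 <= N%:Z by [].
have NL1 : 1 <= (N + 2 * L)%:Z by rewrite lez_nat; lia.
(* [2 c D] is the divisor required by [poly_scale_near]; [2 N] makes [H] and all return times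
   multiples of the block period. The two lower bounds make the approximation errors and the stretch
   [N + 2 L] at most a fraction [1 / M] of any half-period. *)
have [K [K1 cDK NK CMK LMK]] : exists K : int, [/\ 1 <= K, (2 * c * D%:Z %| K)%Z,
    (2 * N%:Z %| K)%Z, C * M%:Z <= K & (N + 2 * L)%:Z * M%:Z <= K].
  exists ((2 * c * D%:Z) * (2 * N%:Z) * (C * M%:Z * (N + 2 * L)%:Z)).
  have cD1 : 1 <= 2 * c * D%:Z by rewrite !ge1M.
  have N1 : 1 <= 2 * N%:Z by rewrite !ge1M.
  have CM1 : 1 <= C * M%:Z by rewrite !ge1M.
  split.
  - by rewrite !ge1M.
  - by rewrite -mulrA dvdz_mulr.
  - by rewrite mulrAC dvdz_mull.
  - have -> : 2 * c * D%:Z * (2 * N%:Z) * (C * M%:Z * (N + 2 * L)%:Z) =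
      (2 * c * D%:Z * (2 * N%:Z) * (N + 2 * L)%:Z) * (C * M%:Z) by ring.
    by rewrite ler_peMl ?ge1M // (le_trans _ CM1).
  - have -> : 2 * c * D%:Z * (2 * N%:Z) * (C * M%:Z * (N + 2 * L)%:Z) =
      (2 * c * D%:Z * (2 * N%:Z) * C) * ((N + 2 * L)%:Z * M%:Z) by ring.
    by rewrite ler_peMl ?ge1M // (le_trans _ (ge1M _ _ NL1 MZ1)).
pose y := scale D r K.
pose n := nb_pairs r; have n0 : (0 < n)%N := nb_pairs_gt0 r.
have y1 j : 1 <= y j := scale_ge1 r D0 K1 j.
have Ky j : K <= y j.
  rewrite (le_trans _ (scale_ge r D0 K1 j)) // ler_peMr //; first by rewrite (le_trans _ K1).
  by rewrite exprn_ege1 // lerDr lower_bound_ge0.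
have yD1 j e : 1 <= y j ^+ e by rewrite exprn_ege1.
(* The half-periods of the three waves of pair [q]; every [i >= 2] gives the third one. *)
pose len (q i : nat) : int := if i is i'.+1 then
    (if i' is 0%N then c * D%:Z * y q.*2 ^+ D.-1 * y q.*2.+1 else c * y q.*2.+1 ^+ D)
  else c * y q.*2 ^+ D.
have Klen q i : K <= len q i.
  have pow j : K <= c * y j ^+ D.
    rewrite (le_trans (Ky j)) // (@le_trans _ _ (y j ^+ D)) ?ler_eXnr //.
    by rewrite ler_peMl // (le_trans _ (yD1 j D)).
  case: i => [|[|i]]; [exact: pow| |exact: pow].
  rewrite /len (le_trans (Ky q.*2.+1)) // ler_peMl //; first by rewrite (le_trans _ (y1 _)).
  by rewrite !ge1M.
have len_gt0 q i : 0 < len q i by rewrite (lt_le_trans _ (Klen q i)) // (lt_le_trans _ K1).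
(* The first scale beyond those in use is a common multiple of all periods. *)
pose H := `|y n.*2|%N; have HE : H%:Z = y n.*2 by rewrite /H; have := y1 n.*2; lia.
have H0 : (0 < H)%N by have := y1 n.*2; rewrite -HE; lia.
have KH : (K %| H%:Z)%Z by rewrite HE dvd_scale.
have len_dvd q i : (q < n)%N -> (2 * len q i %| H%:Z)%Z.
  move=> qn; rewrite HE.
  have pow j (w : int) : (j < n.*2)%N -> (w %| D%:Z * y j ^+ D)%Z -> (2 * (c * w) %| y n.*2)%Z.
    move=> jn wD; apply: dvdz_trans (scale_dvd_lt r K D0 jn).
    apply: dvdz_trans (dvdz_mul cDK (dvdzz (y j ^+ D))).
    have -> : 2 * c * D%:Z * y j ^+ D = 2 * (c * (D%:Z * y j ^+ D)) by ring.
    by rewrite dvdz_mul ?dvdzz // dvdz_mul ?dvdzz.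
  have q2 : (q.*2.+1 < n.*2)%N by rewrite -doubleS leq_double.
  case: i => [|[|i]]; rewrite /len.
  - by apply: (pow q.*2); [rewrite ltn_double|rewrite dvdz_mull].
  - rewrite -!mulrA; apply: (pow q.*2.+1) => //.
    rewrite dvdz_mul ?dvdzz // -(prednK D0) exprSr dvdz_mul ?dvdzz //=.
    by rewrite dvdz_exp2r // scale_dvd.
  - by apply: (pow q.*2.+1); last rewrite dvdz_mull.
(* Only [q < n] enters the average; the empty list lets the hypotheses of [stage] hold for every
   other [q]. *)
pose ls q := if (q < n)%N then [seq len q i | i <- iota 0 3] else [::].
have ls_gt0 q : {in ls q, forall l, 0 < l}.
  by rewrite /ls; case: ifP => // qn l /mapP[i _ ->].
have ls_dvd q : {in ls q, forall l, 2 * l %| H%:Z}%Z.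
  by rewrite /ls; case: ifP => // qn l /mapP[i _ ->]; apply: len_dvd.
have N_dvd : (2 * N%:Z %| H%:Z)%Z := dvdz_trans NK KH.
pose E' := stage E n0 H0 N0 ls_gt0 ls_dvd N_dvd.
pose t (s : nat -> nat) := \sum_(j < n.*2) (s j)%:Z * y j.
(* The sum of the generators with index in [J]: its digit at scale [j] counts the elements of [J] in
   [subset_at r j]. The sum in [L'] bounds all return times at once. *)
pose T (J : {set 'I_r}) := t (fun j => #|J :&: subset_at r j|).
pose L' := (L + N + \sum_(J : {set 'I_r}) `|P.[T J]|)%N.+1.
have ratio_le (a l : int) : 0 < l -> M%:Z * a <= l -> a%:~R / l%:~R <= M%:R^-1 :> R.
  move=> l0 al; rewrite ler_pdivrMr ?ltr0z // -(ler_pM2l (_ : 0 < M%:R)) ?ltr0n //.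
  rewrite mulrA divff ?mul1r; last by rewrite pnatr_eq0 -lt0n.
  by rewrite -[M%:R]/(M%:Z%:~R) -intrM ler_int.
have sum3 (F : nat -> R) : (forall i, F i <= M%:R^-1) ->
    \sum_(i <- iota 0 3) F i <= 3 * M%:R^-1.
  by move=> h; rewrite /= !big_cons big_nil; have := h 0%N; have := h 1%N; have := h 2%N; lra.
exists E', N, L'; split; [by rewrite /L'; lia|by rewrite /L'; lia| |].
  move=> G1 G2 G1L G2L.
  apply: (le_trans (stage_mix E n0 H0 N0 ls_gt0 ls_dvd N_dvd G1L G2L)).
  apply: (@le_trans _ _ (M%:R^-1 + avg n (fun=> 3 * M%:R^-1))); last first.
    by rewrite avg_const //; move: M_eps eps0; lra.
  apply: lerD.
    by apply: (ratio_le (2 * L)%:Z N%:Z); rewrite // -PoszM lez_nat mulnC.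
  apply: ler_avg => q qn; rewrite /ls qn big_map; apply: sum3 => i.
  apply: (ratio_le (N + 2 * L)%:Z) => //.
  by rewrite mulrC (le_trans LMK).
pose ti (i : 'I_r) := t (fun j => (i \in subset_at r j) : nat).
have TE J : T J = \sum_(i in J) ti i.
  rewrite /T /ti /t exchange_big /=; apply: eq_bigr => j _.
  rewrite -mulr_suml; congr (_ * _).
  rewrite -sum1_card (big_morph Posz PoszD (erefl _)) /= [LHS]big_mkcond.
  rewrite [RHS]big_mkcond /=; apply: eq_bigr => i _.
  by rewrite finset.in_setI; case: (i \in J); case: (i \in _).
pose nv (i : 'I_r) : 'rV[int]_d := \row_k (ti i * v k).
have evalE (J : {set 'I_r}) : eval_at p (\sum_(i in J) nv i) = P.[T J].
  rewrite PE /eval_at; apply: meval_eq => k.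
  by rewrite summxE TE mulr_suml; apply: eq_bigr => i _; rewrite mxE.
exists nv.
  move=> i i' nvi; apply/eqP; apply: contraT => ii'.
  have [b Pb] : exists b : int, P.[b] != 0.
    by apply: poly_int_nonroot; rewrite -size_poly_gt0; lia.
  (* If [v] vanished, [P] would be constantly [P(0) = 0]. *)
  have [k vk] : exists k, v k != 0.
    apply/existsP; apply: contraT => /existsPn v0; move: Pb.
    rewrite -P00 !PE; apply: contraNT => _; apply/eqP/meval_eq => k.
    by have := v0 k; rewrite negbK => /eqP ->; rewrite !mulr0.
  have tii' : ti i = ti i'.
    by have := congr1 (fun w : 'rV[int]_d => w ord0 k) nvi; rewrite !mxE => /(mulIf vk).
  have [j jn Sj] := subset_at_set1 i.
  have r0 : (0 < r)%N by case: (r) i {nvi ii' tii' Sj} => [[]|].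
  have bit_le (a : 'I_r) (j0 : nat) : ((a \in subset_at r j0 : nat) <= 1)%N by case: (_ \in _).
  have := scale_digits_inj D0 K1 r0 (bit_le i) (bit_le i') tii' jn.
  by rewrite Sj !finset.in_set1 eqxx eq_sym (negPf ii').
move=> J J0 m; have mE : m = P.[T J] by exact: evalE.
split.
  by rewrite mE /L' (bigD1 J) //= ltnS addnCA leq_addr.
have Ky' j : (K %| y j)%Z by exact: dvd_scale.
(* [K] divides every scale, hence [T J], hence also [m] because [P(0) = 0]. *)
have Nm : (2 * N%:Z %| m)%Z.
  apply: dvdz_trans NK _; have [k] := horner_subz_dvd P (T J) 0.
  rewrite P00 subr0 add0r mE => ->; rewrite dvdz_mulr // /T /t.
  apply: (big_ind (fun z => K %| z)%Z) => [|a b Ka Kb|j _]; rewrite ?dvdz0 //.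
    by rewrite rpredD.
  by rewrite dvdz_mull.
rewrite /E' stage_return //.
have card_r j : (#|J :&: subset_at r j| <= r)%N by rewrite -[leqRHS]card_ord max_card.
apply: (@le_trans _ _ (avg n (fun q => (~~ odd #|J :&: (subset_pair r q).1| &&
     ~~ odd #|J :&: (subset_pair r q).2|)%:R + 3 * M%:R^-1))); last first.
  by rewrite avgD avg_subset_pairs // avg_const // lerD2l; move: M_eps eps0; lra.
apply: ler_avg => q qn; rewrite /ls qn.
have q2 : (q.*2.+1 < n.*2)%N by rewrite -doubleS leq_double.
(* Scale [2q] yields its own wave and the mixed one, scale [2q + 1] the third. *)
have [[e0 [err0 [P0 o0 b0]]] /(_ q2) [e1 [err1 [P1 o1 b1]]]] :=
  near K K1 cDK _ _ _ card_r (ltnW q2).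
have [[e2 [err2 [P2 o2 b2]]] _] := near K K1 cDK _ _ _ card_r q2.
pose e i := nth 0 [:: e0; e1; e2] i; pose err i := nth 0 [:: err0; err1; err2] i.
have m_len : {in iota 0 3, forall i, m = len q i * e i + err i}.
  by move=> i; rewrite !inE => /or3P[] /eqP ->; rewrite mE.
have len_dvd1 : {in iota 0 3, forall i, len q i %| H%:Z}%Z.
  by move=> i _; apply: dvdz_trans (len_dvd q i qn); rewrite dvdz_mull.
have len_gt0' : {in iota 0 3, forall i, 0 < len q i} by [].
apply: (le_trans (parity_wave_shift R H0 len_gt0' len_dvd1 m_len)).
apply: lerD.
  (* The exclusive or of [s], [s s'] and [s'] is the disjunction of [s] and [s']. *)
  rewrite /= !big_cons big_nil /e /= o0 o1 o2 subset_at_double subset_at_doubleS.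
  by case: (odd _); case: (odd _).
apply: sum3 => i; apply: ratio_le => //.
have C0 : 0 < C by rewrite (lt_le_trans _ C1).
have err_le l a : K * `|a| <= C * l -> M%:Z * `|a| <= l.
  move=> h; rewrite -(ler_pM2l C0) (le_trans _ h) // mulrA ler_wpM2r //.
case: i => [|[|[|i]]]; try exact: err_le.
(* Beyond the three waves the error is the default value 0. *)
by rewrite /err nth_default // normr0 mulr0 ltW.
Qed.

Local Open Scope classical_set_scope.
Local Open Scope ring_scope.

(** * The limit measure *)

(** The order 0, -1, 1, -2, ... of the integers, chosen because its first [2 L] terms fill the
    window [[-L, L[]. *)
Definition int_code (z : int) : nat :=
  match z with Posz n => n.*2 | Negz n => n.*2.+1 end.

Definition int_decode (n : nat) : int := if odd n then Negz n./2 else Posz n./2.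

Lemma int_decodeK : cancel int_decode int_code.
Proof. by move=> n; rewrite /int_decode; case: ifPn => h /=; lia. Qed.

Lemma int_codeK : cancel int_code int_decode.
Proof.
by case=> n; rewrite /int_decode /= odd_double /= ?doubleK // uphalf_double.
Qed.

Lemma int_code_lt (L : nat) (z : int) : (int_code z < L.*2)%N = (- L%:Z <= z < L%:Z).
Proof. by case: z => n /=; lia. Qed.

(* The most recent coordinate comes first in a word. *)
Fixpoint cyl (w : seq bool) (f : int -> bool) : bool :=
  if w is b :: w' then (f (int_decode (size w')) == b) && cyl w' f else true.

Lemma cyl_split w f : cyl w f = cyl (false :: w) f || cyl (true :: w) f.
Proof. by rewrite /=; case: (f _); rewrite /= ?orbF. Qed.

Lemma cyl_agree w f g z : cyl w f -> cyl w g -> (int_code z < size w)%N -> f z = g z.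
Proof.
elim: w => //= b w IH /andP[/eqP fb fw] /andP[/eqP gb gw].
rewrite ltnS leq_eqVlt => /predU1P[zw|]; last exact: IH.
by rewrite -(int_codeK z) zw fb gb.
Qed.

Lemma cyl_local w : local (size w) (cyl w).
Proof.
suff h n : (size w <= n)%N -> local n (cyl w) by apply: h.
elim: w => //= b w IH wn f g fg; rewrite (IH (ltnW wn) _ _ fg) fg //.
by rewrite -int_code_lt int_decodeK -addnn; lia.
Qed.

(** A word of length [2 L] fixes the whole window, so [G] is constant on its cylinder. Splitting the
    trivial cylinder down to this length builds [G] from cylinders and empty pieces by disjoint
    unions. *)
Lemma local_cyl_ind (L : nat) (G : (int -> bool) -> bool)
    (Q : ((int -> bool) -> bool) -> Prop) :
  local L G -> (forall w, Q (cyl w)) -> Q (fun=> false) ->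
  (forall w F, Q (fun f => F f && cyl (false :: w) f) ->
     Q (fun f => F f && cyl (true :: w) f) -> Q (fun f => F f && cyl w f)) ->
  Q G.
Proof.
move=> GL Qcyl Q0 Qsplit.
have main n w : (size w + n = L.*2)%N -> Q (fun f => G f && cyl w f).
  elim: n w => [|n IH] w wn; last by apply: Qsplit; apply: IH => /=; lia.
  have [[f [fw Gf]]|no] := pselect (exists f, cyl w f /\ G f).
    have -> : (fun f => G f && cyl w f) = cyl w => //.
    apply/funext => g; apply/andP/idP => [[]//|gw]; split=> //.
    rewrite -(GL f g) // => z zL; apply: (cyl_agree fw gw).
    by rewrite -[size w]addn0 wn int_code_lt.
  have -> : (fun f => G f && cyl w f) = (fun=> false) => //.
  apply/funext => g; apply/negbTE/negP => /andP[Gg gw]; apply: no.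
  by exists g.
have -> : G = (fun f => G f && cyl [::] f) by apply/funext => f; rewrite andbT.
by apply: (main L.*2).
Qed.

Lemma local_widen (T : Type) (L L' : nat) (G : (int -> bool) -> T) :
  (L <= L')%N -> local L G -> local L' G.
Proof. by move=> LL GL f g fg; apply: GL => z zL; apply: fg; lia. Qed.

Definition local_events : set (set (int -> bool)) :=
  [set A | exists (L : nat) (G : (int -> bool) -> bool), local L G /\ A = [set f | G f]].

Notation path_space := (g_sigma_algebraType local_events).

Lemma measurable_local L (G : (int -> bool) -> bool) : local L G ->
  measurable ([set f | G f] : set path_space).
Proof. by move=> GL; apply: sub_sigma_algebra; exists L, G. Qed.

Lemma local_events_setI : setI_closed local_events.
Proof.
move=> _ _ [L1 [G1 [G1L ->]]] [L2 [G2 [G2L ->]]].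
exists (maxn L1 L2), (fun f => G1 f && G2 f); split.
  move=> f g fg; rewrite (local_widen (leq_maxl _ _) G1L fg).
  by rewrite (local_widen (leq_maxr _ _) G2L fg).
by apply/seteqP; split=> f /=; [case=> -> ->|move/andP].
Qed.

Lemma local_events_setT : local_events setT.
Proof. by exists 0%N, (fun=> true); split=> //; apply/seteqP; split. Qed.

(** * Sequences coded by points of the unit interval *)

Section Quantile.
Variables (R : realType) (p : seq bool -> R).
Hypotheses (p_nil : p [::] = 1) (p_ge0 : forall w, 0 <= p w).
Hypothesis p_split : forall w, p w = p (false :: w) + p (true :: w).

(* Words correspond to nested intervals [left_end w, left_end w + p w[. *)
Fixpoint left_end (w : seq bool) : R :=
  if w is b :: w' then left_end w' + (if b then p (false :: w') else 0) else 0.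

(** Bisection: for [x] in [[0, 1[] this is the word of length [n] whose interval contains [x]. *)
Fixpoint prefix_word (x : R) (n : nat) : seq bool :=
  if n is n'.+1 then
    (left_end (prefix_word x n') + p (false :: prefix_word x n') <= x) :: prefix_word x n'
  else [::].

Definition quantile_path (x : R) : path_space :=
  fun z => head false (prefix_word x (int_code z).+1).

Lemma cyl_quantile x w : cyl w (quantile_path x) = (prefix_word x (size w) == w).
Proof.
by elim: w => //= b w ->; rewrite /quantile_path int_decodeK.
Qed.

Lemma prefix_wordE x w : 0 <= x < 1 ->
  (prefix_word x (size w) == w) = (left_end w <= x < left_end w + p w).
Proof.
move=> x01; elim: w => [|b w IH] /=; first by rewrite p_nil add0r x01.
rewrite eqseq_cons; have [e|ne] := eqVneq (prefix_word x (size w)) w.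
  move: IH; rewrite e eqxx => /esym/andP[h1 h2].
  have := p_split w; case: b => /= ps.
    by rewrite andbT -addrA -ps h2 andbT; case: (_ <= x).
  rewrite andbT addr0 h1 /= ltNge; by case: (_ <= x).
rewrite andbF; apply/esym/negbTE; apply: contraNN ne => h; rewrite IH.
have := p_split w; have := p_ge0 (false :: w); have := p_ge0 (true :: w).
by move: h; case: b => /=; lra.
Qed.

Lemma measurable_prefix_word w :
  measurable ([set x | prefix_word x (size w) == w] : set (measurableTypeR R)).
Proof.
elim: w => [|b w IH] /=; first by rewrite (_ : [set _ | _] = setT) //; apply/seteqP; split.
have -> : [set x : R |
      (left_end (prefix_word x (size w)) + p (false :: prefix_word x (size w)) <= x)
    :: prefix_word x (size w) == b :: w] =
  [set x | prefix_word x (size w) == w] `&`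
  [set` if b then `[left_end w + p (false :: w), +oo[ else `]-oo, left_end w + p (false :: w)[].
  apply/seteqP; split=> x /=; rewrite eqseq_cons.
    move=> /andP[/eqP + /eqP e]; rewrite e => <-; split=> //.
    by case: lerP => h /=; rewrite in_itv /= ?h.
  move=> [/eqP e]; rewrite e eqxx andbT; case: b => /=; rewrite in_itv /= ?andbT.
    by move=> ->.
  by rewrite ltNge => /negbTE ->.
by apply: measurableI => //; case: b; apply: measurable_itv.
Qed.

Lemma measurable_quantile_path :
  measurable_fun (setT : set (measurableTypeR R)) quantile_path.
Proof.
apply: (@measurability _ _ _ path_space _ _ local_events) => //.
move=> _ [_ [L [G [GL ->]]] <-]; rewrite setTI.
pose Q F := measurable ([set x | F (quantile_path x)] : set (measurableTypeR R)).
apply: (@local_cyl_ind L G Q GL); rewrite /Q.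
- move=> w; rewrite (_ : [set _ | _] = [set x | prefix_word x (size w) == w]).
    exact: measurable_prefix_word.
  by apply/seteqP; split=> x /=; rewrite cyl_quantile.
- by rewrite (_ : [set _ | _] = set0) //; apply/seteqP; split.
- move=> w F m0 m1; rewrite (_ : [set _ | _] =
    [set x | F (quantile_path x) && cyl (false :: w) (quantile_path x)] `|`
    [set x | F (quantile_path x) && cyl (true :: w) (quantile_path x)]).
    exact: measurableU.
  apply/seteqP; split=> x; rewrite /setU /mkset; last first.
    by case=> /andP[-> h]; rewrite cyl_split h ?orbT.
  by rewrite [cyl w _]cyl_split => /andP[-> /orP[->|->]]; [left|right].
Qed.

End Quantile.

Section UnitInterval.
Variable R : realType.

Definition unit_measure : set (measurableTypeR R) -> \bar R :=
  mrestr (@lebesgue_measure R) (measurable_itv `[0, 1[).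

HB.instance Definition _ := measure_function.Measure.on unit_measure.

Fact unit_measure_setT : unit_measure setT = 1%E.
Proof.
by rewrite /unit_measure /mrestr setTI lebesgue_measure_itv /= lte_fin ltr01 oppr0 adde0.
Qed.

HB.instance Definition _ :=
  Measure_isProbability.Build _ _ _ unit_measure unit_measure_setT.

(** Kolmogorov extension for two-valued sequences: [mu] is the law of [quantile_path] under Lebesgue
    measure on [[0, 1[], where the points with word [w] form an interval of length [p w]. *)
Lemma word_measure (p : seq bool -> R) :
  p [::] = 1 -> (forall w, 0 <= p w) ->
  (forall w, p w = p (false :: w) + p (true :: w)) ->
  exists mu : probability path_space R, forall w, mu [set f | cyl w f] = (p w)%:E.
Proof.
move=> p_nil p_ge0 p_split.
pose q := @mfun_Sub _ _ (measurableTypeR R) path_space _ (mem_set (@measurable_quantile_path R p)).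
exists (@distribution _ _ (measurableTypeR R) path_space R unit_measure q) => w.
rewrite /distribution /pushforward /= /unit_measure /mrestr.
have -> : quantile_path p @^-1` [set f | cyl w f] `&` `[0, 1[ =
    `[left_end p w, left_end p w + p w[%classic.
  apply/seteqP; split=> x /=; rewrite !in_itv /= cyl_quantile.
    by case=> /eqP e /(prefix_wordE p_nil p_ge0 p_split w) <-; rewrite e.
  move=> xw; have x01 : 0 <= x < 1.
    elim: w xw => [|b w IH] /=; first by rewrite p_nil add0r.
    have := p_split w; have := p_ge0 (false :: w); have := p_ge0 (true :: w).
    move=> h1 h2 h3 h; apply: IH; move: h; case: b => /andP[]; rewrite ?addr0; lra.
  by rewrite (prefix_wordE p_nil p_ge0 p_split).
rewrite lebesgue_measure_itv /= lte_fin ltrDl; case: ltP => [_|pw].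
  by rewrite -EFinD addrAC subrr add0r.
by congr EFin; apply/eqP; rewrite eq_le p_ge0 pw.
Qed.

End UnitInterval.

Section LimitMeasure.
Variables (R : realType) (E : nat -> mean R).
Hypothesis E_cvg : forall L (G : (int -> bool) -> bool), local L G ->
  cvgn (fun k => E k (fun f => (G f)%:R)).

(** Limits of cylinder probabilities remain nonnegative and additive under splitting, so they define
    a measure; other local events follow by decomposition into cylinders. *)
Lemma limit_measure : exists mu : probability path_space R,
  forall L (G : (int -> bool) -> bool), local L G ->
  (fun k => E k (fun f => (G f)%:R)) @ \oo --> fine (mu [set f | G f]).
Proof.
pose p w := limn (fun k => E k (fun f => (cyl w f)%:R)).
have p_cvg w : (fun k => E k (fun f => (cyl w f)%:R)) @ \oo --> p w.
  exact: E_cvg (@cyl_local w).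
have [||w|mu muE] := @word_measure R p.
- rewrite /p; apply/cvg_lim => //.
  rewrite (_ : (fun k => _) = fun=> 1); first exact: cvg_cst.
  by apply/funext => k; rewrite ev1.
- move=> w; apply: limr_ge; first exact: p_cvg.
  by near=> k; apply: ev_ge0.
- apply/cvg_lim => //.
  rewrite (_ : (fun k => _) = (fun k => E k (fun f => (cyl (false :: w) f)%:R) +
      E k (fun f => (cyl (true :: w) f)%:R))); first exact: cvgD.
  apply/funext => k; rewrite -evD; apply: eq_ev => f /=.
  by case: (f _); case: cyl; rewrite ?addr0 ?add0r.
exists mu => L G GL.
pose Q (F : (int -> bool) -> bool) := measurable ([set f | F f] : set path_space) /\
  (fun k => E k (fun f => (F f)%:R)) @ \oo --> fine (mu [set f | F f]).
suff : Q G by case.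
apply: (local_cyl_ind GL); rewrite /Q.
- move=> w; split; first exact: measurable_local (@cyl_local w).
  by rewrite muE.
- rewrite (_ : [set _ | _] = set0); last by apply/seteqP; split.
  split=> //; rewrite measure0 (_ : (fun k => _) = fun=> 0); first exact: cvg_cst.
  by apply/funext => k; rewrite ev0.
move=> w F [m0 c0] [m1 c1].
have e : [set f | F f && cyl w f] =
    [set f | F f && cyl (false :: w) f] `|` [set f | F f && cyl (true :: w) f].
  apply/seteqP; split=> f; rewrite /setU /mkset; last first.
    by case=> /andP[-> h]; rewrite cyl_split h ?orbT.
  by rewrite [cyl w _]cyl_split => /andP[-> /orP[->|->]]; [left|right].
rewrite e; split; first exact: measurableU.
rewrite measureU //; last first.
  by apply/seteqP; split=> f //= [/and3P[_ /eqP-> _] /and3P[_ /eqP]].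
rewrite fineD ?fin_num_measure //.
rewrite (_ : (fun k => _) = (fun k => E k (fun f => (F f && cyl (false :: w) f)%:R) +
      E k (fun f => (F f && cyl (true :: w) f)%:R))); first exact: cvgD.
apply/funext => k; rewrite -evD; apply: eq_ev => f /=.
by case: (f _); case: cyl; case: (F f); rewrite ?addr0 ?add0r.
Unshelve. all: by end_near. Qed.

End LimitMeasure.

(** * The shift as an invertible system *)

Section Shift.
Variables (R : realType) (mu : probability path_space R).

Definition translate (m : int) (f : path_space) : path_space := fun z => f (z + m).

Lemma translateK m : cancel (translate m) (translate (- m)).
Proof. by move=> f; apply/funext => z; rewrite /translate subrK. Qed.

Lemma translateNK m : cancel (translate (- m)) (translate m).
Proof. by move=> f; apply/funext => z; rewrite /translate addrK. Qed.

Lemma translateD a b f : translate a (translate b f) = translate (a + b) f.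
Proof. by apply/funext => z; rewrite /translate addrA. Qed.

Lemma local_shift (T : Type) L (G : (int -> bool) -> T) (m : int) :
  local L G -> local (L + `|m|) (fun f => G (translate m f)).
Proof. by move=> GL f g fg; apply: GL => z zL; apply: fg; lia. Qed.

Lemma measurable_translate (m : int) :
  measurable_fun setT (translate m).
Proof.
apply: (@measurability _ _ path_space path_space _ _ local_events) => // _ [_ [L [G [GL ->]]] <-].
by rewrite setTI; apply: measurable_local (local_shift (m := m) GL).
Qed.

Hypothesis mu_translate : forall m L (G : (int -> bool) -> bool), local L G ->
  mu [set f | G (translate m f)] = mu [set f | G f].

(** Both sides are finite measures of [A] that agree on local events, a generating class closed
    under intersection. *)
Lemma translate_preserving m (A : set path_space) : measurable A ->
  mu (translate m @^-1` A) = mu A.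
Proof.
move=> mA; pose q := @mfun_Sub _ _ path_space path_space _ (mem_set (measurable_translate m)).
have le_events : local_events `<=` (measurable : set (set path_space)).
  by move=> _ [L [G [GL ->]]]; apply: measurable_local GL.
apply: (@g_sigma_algebra_measure_unique _ R path_space local_events le_events
  (fun=> setT) (fun=> local_events_setT) _ (distribution mu q) mu local_events_setI) => //.
- by rewrite bigcup_const //; exists 0%N.
- by move=> _ [L [G [GL ->]]]; apply: mu_translate GL.
- by move=> _; apply: le_lt_trans (probability_le1 (distribution mu q) _) _; rewrite ?ltry.
Qed.

Definition shift_mpt : invertible_mpt mu :=
  InvertibleMPT (translateK 1) (translateNK 1) (measurable_translate 1)
    (measurable_translate (-1)) (translate_preserving 1).

Lemma mpt_pow_shift (m : int) : mpt_pow shift_mpt m = translate m.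
Proof.
have iterE e k f : iter k (translate e) f = translate (k%:Z * e) f.
  elim: k f => [|k IH] f; first by apply/funext => z; rewrite /translate mul0r addr0.
  by rewrite iterS IH translateD intS mulrDl mul1r.
apply/funext => f; case: m => k; rewrite /mpt_pow /=.
  by rewrite iterE mulr1.
by rewrite -iterS iterE mulrN1 NegzE.
Qed.

End Shift.

(** * Weak mixing *)

Section Covariance.
Context {R : realType} {disp : measure_display} {X : measurableType disp}.
Variable mu : probability X R.

Definition pr (A : set X) : R := fine (mu A).

Definition cov (A B : set X) : R := pr (A `&` B) - pr A * pr B.

Lemma pr_itv A : measurable A -> 0 <= pr A <= 1.
Proof.
move=> mA; rewrite /pr fine_ge0 ?measure_ge0 //=.
rewrite -[1]/(fine 1%:E) fine_le ?fin_num_measure //; exact: probability_le1.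
Qed.

Lemma pr_split B E : measurable B -> measurable E ->
  pr B = pr (B `&` E) + pr (B `\` E).
Proof.
move=> mB mE; rewrite /pr addrC -fineD ?fin_num_measure //; first by rewrite -measureDI.
  exact: measurableD.
exact: measurableI.
Qed.

Lemma pr_le A B : measurable A -> measurable B -> A `<=` B -> pr A <= pr B.
Proof.
by move=> mA mB AB; rewrite fine_le ?fin_num_measure // le_measure ?inE.
Qed.

Lemma covC A B : cov A B = cov B A.
Proof. by rewrite /cov setIC mulrC. Qed.

Lemma cov_itv A B : measurable A -> measurable B -> -1 <= cov A B <= 1.
Proof.
move=> mA mB; rewrite /cov; have := pr_itv mA; have := pr_itv mB.
have := pr_itv (measurableI _ _ mA mB); nra.
Qed.

Let lin (s : seq (R * set X)) (B : set X) := \sum_(x <- s) x.1 * pr (B `&` x.2).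
Let quad (s : seq (R * set X)) (B : set X) :=
  \sum_(x <- s) \sum_(y <- s) x.1 * y.1 * pr (B `&` (x.2 `&` y.2)).

(* The quantity is the integral over [B] of the square of the step function
   c + sum of x.1 * 1_{x.2}; splitting [B] along the first set of [s]
   absorbs this set in the constant [c]. *)
Let gram_ge0 B c s : measurable B -> {in s, forall x, measurable x.2} ->
  0 <= c ^+ 2 * pr B + 2 * c * lin s B + quad s B.
Proof.
elim: s B c => [|[a E] s IH] B c mB ms.
  rewrite /lin /quad !big_nil mulr0 !addr0 mulr_ge0 ?sqr_ge0 //.
  by have /andP[] := pr_itv mB.
have mE : measurable E by apply: (ms (a, E)); rewrite mem_head.
have {}ms : {in s, forall x, measurable x.2}.
  by move=> x xs; apply: ms; rewrite in_cons xs orbT.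
have mBE := measurableI _ _ mB mE; have mBD := measurableD mB mE.
have := addr_ge0 (IH _ (c + a) mBE ms) (IH _ c mBD ms); congr (0 <= _).
have cut F : measurable F -> pr (B `&` F) = pr (B `&` E `&` F) + pr ((B `\` E) `&` F).
  move=> mF; rewrite (pr_split (measurableI _ _ mB mF) mE).
  by rewrite setIAC setIDAC setIDA.
have linS : lin s B = lin s (B `&` E) + lin s (B `\` E).
  by rewrite /lin -big_split; apply: eq_big_seq => x /ms mx; rewrite /= -mulrDr cut.
have quadS : quad s B = quad s (B `&` E) + quad s (B `\` E).
  rewrite /quad -big_split; apply: eq_big_seq => x /ms mx; rewrite /= -big_split.
  apply: eq_big_seq => y /ms my; rewrite /= -mulrDr cut //; exact: measurableI.
have lin_cons : lin ((a, E) :: s) B = a * pr (B `&` E) + lin s B.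
  by rewrite /lin big_cons.
have quad_cons : quad ((a, E) :: s) B =
    a ^+ 2 * pr (B `&` E) + 2 * a * lin s (B `&` E) + quad s B.
  rewrite /quad big_cons big_cons /= setIid.
  have -> : \sum_(x <- s) \sum_(y <- (a, E) :: s) x.1 * y.1 * pr (B `&` (x.2 `&` y.2)) =
      a * lin s (B `&` E) + quad s B.
    rewrite /lin /quad mulr_sumr -big_split; apply: eq_bigr => x _.
    by rewrite big_cons /= -setIA (setIC x.2 E) mulrCA mulrA.
  have -> : \sum_(y <- s) a * y.1 * pr (B `&` (E `&` y.2)) = a * lin s (B `&` E).
    by rewrite /lin mulr_sumr; apply: eq_bigr => y _; rewrite -setIA mulrA.
  by rewrite /quad; ring.
by rewrite lin_cons quad_cons linS quadS (pr_split mB mE); ring.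
Qed.

(** The double sum is the variance of a step function: in [gram_ge0] over the whole space, [c] is
    minus its mean. *)
Lemma cov_psd (s : seq (R * set X)) : {in s, forall x, measurable x.2} ->
  0 <= \sum_(x <- s) \sum_(y <- s) x.1 * y.1 * cov x.2 y.2.
Proof.
move=> ms; pose c := - \sum_(x <- s) x.1 * pr x.2.
have := gram_ge0 c measurableT ms.
have -> : lin s setT = - c by rewrite /c opprK; apply: eq_bigr => x _; rewrite setTI.
have -> : quad s setT = \sum_(x <- s) \sum_(y <- s) x.1 * y.1 * pr (x.2 `&` y.2).
  by apply: eq_bigr => x _; apply: eq_bigr => y _; rewrite setTI.
have -> : pr setT = 1 by rewrite /pr probability_setT.
set q := \sum_(x <- s) _.
have -> : \sum_(x <- s) \sum_(y <- s) x.1 * y.1 * cov x.2 y.2 = q - c ^+ 2.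
  rewrite /q /c sqrrN expr2 mulr_suml -sumrB; apply: eq_bigr => x _.
  rewrite mulr_sumr -sumrB; apply: eq_bigr => y _; rewrite /cov; ring.
by move=> h; rewrite (le_trans h) // le_eqVlt; apply/orP; left; apply/eqP; ring.
Qed.

(** Positivity is applied to the sum of the indicators of the [E] in [s], with the signs of
    [cov A E], minus [S] times the indicator of [A]. This gives [2 S^2 <= S^2 cov A A] plus the
    double sum, and [cov A A <= 1]. *)
Lemma cov_bessel (A : set X) (s : seq (set X)) : measurable A ->
  {in s, forall E, measurable E} ->
  (\sum_(E <- s) `|cov A E|) ^+ 2 <= \sum_(E <- s) \sum_(F <- s) `|cov E F|.
Proof.
move=> mA ms; set S := \sum_(E <- s) `|cov A E|.
pose t := [seq (Num.sg (cov A E), E) | E <- s].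
have := @cov_psd ((- S, A) :: t).
have -> : \sum_(x <- (- S, A) :: t) \sum_(y <- (- S, A) :: t) x.1 * y.1 * cov x.2 y.2 =
    S ^+ 2 * cov A A - 2 * S ^+ 2 +
    \sum_(E <- s) \sum_(F <- s) Num.sg (cov A E) * Num.sg (cov A F) * cov E F.
  rewrite !big_cons /= /t !big_map /=.
  have -> : \sum_(E <- s) \sum_(y <- (- S, A) :: [seq (Num.sg (cov A E), E) | E <- s])
      Num.sg (cov A E) * y.1 * cov E y.2 =
    - S * S + \sum_(E <- s) \sum_(F <- s) Num.sg (cov A E) * Num.sg (cov A F) * cov E F.
    rewrite {3}/S mulr_sumr -big_split; apply: eq_bigr => E _.
    by rewrite big_cons big_map /= (covC E A) normrEsg; congr (_ + _); ring.
  have -> : \sum_(E <- s) - S * Num.sg (cov A E) * cov A E = - S * S.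
    by rewrite {3}/S mulr_sumr; apply: eq_bigr => E _; rewrite normrEsg; ring.
  ring.
move=> h.
have S0 : 0 <= S by rewrite sumr_ge0.
have {}h := h _; have /andP[_ cA] := cov_itv mA mA.
have : 0 <= S ^+ 2 * cov A A - 2 * S ^+ 2 +
    \sum_(E <- s) \sum_(F <- s) Num.sg (cov A E) * Num.sg (cov A F) * cov E F.
  apply: h => x; rewrite in_cons => /predU1P[-> //|/mapP[E Es ->]]; exact: ms.
have : \sum_(E <- s) \sum_(F <- s) Num.sg (cov A E) * Num.sg (cov A F) * cov E F <=
    \sum_(E <- s) \sum_(F <- s) `|cov E F|.
  apply: ler_sum => E _; apply: ler_sum => F _; apply: (le_trans (ler_norm _)).
  by rewrite !normrM !normr_sg -natrM mulnb ler_piMl // lern1 leq_b1.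
have : S ^+ 2 * cov A A <= S ^+ 2 by rewrite ler_piMr ?sqr_ge0.
by lra.
Qed.

End Covariance.

(** * From mixing along a sequence of gaps to weak mixing *)

Section WeakMixing.
Variables (R : realType) (mu : probability path_space R).
Hypothesis mu_translate : forall m L (G : (int -> bool) -> bool), local L G ->
  mu [set f | G (translate m f)] = mu [set f | G f].

Lemma measurable_translate_preimage m (A : set path_space) : measurable A ->
  measurable (translate m @^-1` A).
Proof. by move=> mA; rewrite -[X in measurable X]setTI; apply: measurable_translate. Qed.

Lemma pr_translate m (A : set path_space) : measurable A ->
  pr mu (translate m @^-1` A) = pr mu A.
Proof. by move=> mA; rewrite /pr translate_preserving. Qed.

Lemma cov_translate m (A B : set path_space) : measurable A -> measurable B ->
  cov mu (translate m @^-1` A) (translate m @^-1` B) = cov mu A B.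
Proof.
move=> mA mB; rewrite /cov -preimage_setI !pr_translate //; exact: measurableI.
Qed.

Lemma translate_preimageD a b (A : set path_space) :
  translate a @^-1` (translate b @^-1` A) = translate (a + b) @^-1` A.
Proof. by apply/seteqP; split=> f /=; rewrite translateD addrC. Qed.

Variable gap : nat -> nat.
Hypothesis gap_local : forall L1 L2 (G1 G2 : (int -> bool) -> bool),
  local L1 G1 -> local L2 G2 ->
  (fun k => cov mu [set f | G1 f] (translate (gap k) @^-1` [set f | G2 f])) @ \oo --> 0.

(** The bound by [pr mu A] is uniform in [k]: in an increasing union, what remains beyond [F n]
    costs little for all [k] at once. *)
Lemma lambda_system_cov_to0 (c : nat -> set path_space -> R) :
  (forall k A, measurable A -> `|c k A| <= pr mu A) ->
  (forall k, c k setT = 0) ->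
  (forall k A B, measurable A -> measurable B -> B `<=` A ->
     c k (A `\` B) = c k A - c k B) ->
  lambda_system setT [set A | measurable A /\ (fun k => c k A) @ \oo --> 0].
Proof.
move=> c_le cT cD; split => //=.
- split=> //; rewrite (_ : (fun k => _) = fun=> 0); first exact: cvg_cst.
  by apply/funext.
- move=> A B BA [mA cA] [mB cB]; split; first exact: measurableD.
  rewrite (_ : (fun k => _) = (fun k => c k A - c k B)).
    by rewrite -[X in _ --> X](subrr 0); apply: cvgB.
  by apply/funext => k; rewrite cD.
move=> F ndF F_; have mF n : measurable (F n) by have [] := F_ n.
have mU : measurable (\bigcup_n F n) by apply: bigcup_measurable.
split=> //; apply/cvgrPdist_lt => e e0.
have prF : (fun n => pr mu (F n)) @ \oo --> pr mu (\bigcup_n F n).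
  apply: fine_cvg; rewrite fineK ?fin_num_measure //.
  exact: nondecreasing_cvg_mu.
have [n _ /(_ n (leqnn n)) /= Fn] := (cvgrPdist_lt _ _).1 prF (e / 2) (divr_gt0 e0 (ltr0n _ 2)).
have [_ cF] := F_ n.
have cF' := (cvgrPdist_lt _ _).1 cF (e / 2) (divr_gt0 e0 (ltr0n _ 2)).
near=> k; rewrite sub0r normrN.
have ck : `|c k (F n)| < e / 2 by rewrite -normrN -sub0r; near: k; exact: cF'.
have FU : F n `<=` \bigcup_n F n by apply: bigcup_sup.
have -> : c k (\bigcup_n F n) = c k (F n) + c k ((\bigcup_n F n) `\` F n).
  by rewrite (cD _ _ _ mU (mF n) FU) addrCA subrr addr0.
apply: (le_lt_trans (ler_normD _ _)); rewrite [e]splitr ltrD //.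
apply: (le_lt_trans (c_le _ _ (measurableD mU (mF n)))).
have := pr_split mu mU (mF n); rewrite setIC (setIidl FU) => prU.
by apply: le_lt_trans Fn; rewrite prU addrC addKr ler_norm.
Unshelve. all: by end_near. Qed.

Lemma cov_le (A B : set path_space) : measurable A -> measurable B -> `|cov mu A B| <= pr mu A.
Proof.
move=> mA mB; have mAB := measurableI _ _ mA mB.
have := pr_itv mu mA; have := pr_itv mu mB; have := pr_itv mu mAB.
have := pr_le mu mAB mA (@subIsetl _ A B).
by rewrite /cov ler_norml; nra.
Qed.

Lemma cov_setTl (B : set path_space) : cov mu setT B = 0.
Proof. by rewrite /cov setTI {2}/pr probability_setT mul1r subrr. Qed.

Lemma cov_setDl (A B C : set path_space) : measurable A -> measurable B -> measurable C ->
  B `<=` A -> cov mu (A `\` B) C = cov mu A C - cov mu B C.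
Proof.
move=> mA mB mC BA; rewrite /cov.
rewrite (pr_split mu mA mB) (pr_split mu (measurableI _ _ mA mC) mB).
have -> : A `&` C `&` B = B `&` C by rewrite setIAC; congr (_ `&` _); apply: setIidr.
have -> : A `&` C `\` B = (A `\` B) `&` C by rewrite setIDAC setIDA.
have -> : A `&` B = B by apply: setIidr.
ring.
Qed.

(** Two passes of the monotone class argument from local events: first in the second set with the
    first one local, then in the first set. *)
Lemma cov_gap_to0 (A B : set path_space) : measurable A -> measurable B ->
  (fun k => cov mu A (translate (gap k) @^-1` B)) @ \oo --> 0.
Proof.
move=> mA mB.
have tr m C : measurable C -> measurable (translate m @^-1` C) :=
  @measurable_translate_preimage m C.
have mT (C : set (set path_space)) : <<s local_events >> `<=` C ->
    forall D : set path_space, measurable D -> C D by [].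
pose cA k C := cov mu C (translate (gap k) @^-1` B).
pose cB A' k C := cov mu A' (translate (gap k) @^-1` C).
have fix_local L (G : (int -> bool) -> bool) : local L G ->
    (fun k => cov mu [set f | G f] (translate (gap k) @^-1` B)) @ \oo --> 0.
  move=> GL; have mG := measurable_local GL.
  suff : [set C | measurable C /\ (fun k => cB [set f | G f] k C) @ \oo --> 0] B by case.
  apply: (mT) mB; apply: (lambda_system_subset local_events_setI) => //.
    apply: lambda_system_cov_to0 => [k C mC|k|k C D mC mD DC]; rewrite /cB.
    - by rewrite covC -(pr_translate (gap k) mC) cov_le //; apply: tr.
    - by rewrite covC preimage_setT cov_setTl.
    - rewrite !(covC mu [set f | G f]).
      rewrite -[translate _ @^-1` (C `\` D)]/(translate _ @^-1` C `\` translate _ @^-1` D).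
      by apply: cov_setDl; [exact: tr|exact: tr|exact: mG|exact: preimage_subset].
  move=> _ [L' [G' [GL' ->]]]; split; first exact: measurable_local GL'.
  exact: gap_local GL GL'.
suff : [set C | measurable C /\ (fun k => cA k C) @ \oo --> 0] A by case.
apply: (mT) mA; apply: (lambda_system_subset local_events_setI) => //.
  apply: lambda_system_cov_to0 => [k C mC|k|k C D mC mD DC]; rewrite /cA.
  - by apply: cov_le => //; apply: tr.
  - exact: cov_setTl.
  - by apply: cov_setDl => //; apply: tr.
move=> _ [L [G [GL ->]]]; split; first exact: measurable_local GL.
exact: fix_local GL.
Qed.

(** The times are chosen one after another, each gap so late that its translate is nearly
    uncorrelated with all those already chosen. *)
Lemma almost_independent_gaps (B : set path_space) (K : nat) (delta : R) :
  measurable B -> 0 < delta -> exists ts : seq nat, size ts = K /\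
  pairwise (fun s t : nat =>
    `|cov mu (translate s @^-1` B) (translate t @^-1` B)| <= delta) ts.
Proof.
move=> mB d0; elim: K => [|K [ts [tsK pts]]]; first by exists [::].
have : \forall k \near \oo, all (fun t : nat =>
    `|cov mu (translate (gap k) @^-1` B) (translate t @^-1` B)| <= delta) ts.
  elim: (ts) => [|t s IH]; first by near=> k.
  have := cov_gap_to0 (measurable_translate_preimage t%:Z mB) mB.
  move=> /cvgrPdist_le /(_ _ d0) h; near=> k => /=; apply/andP; split; last by near: k; exact: IH.
  by rewrite covC -normrN -sub0r; near: k; exact: h.
move=> [k _ /(_ k (leqnn k)) /= hk].
by exists (gap k :: ts); rewrite /= tsK hk.
Unshelve. all: by end_near. Qed.

(** The diagonal costs 1 per element and every other pair at most [delta]; [pairwise] sees one order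
    of each pair, symmetry gives the other. *)
Lemma sum_pairwise_le (ts : seq nat) (g : nat -> nat -> R) (delta : R) :
  (forall s t, g s t = g t s) -> (forall s, g s s <= 1) -> 0 <= delta ->
  pairwise (fun s t => g s t <= delta) ts ->
  \sum_(s <- ts) \sum_(t <- ts) g s t <= (size ts)%:R + (size ts)%:R ^+ 2 * delta.
Proof.
move=> gC g1 d0; elim: ts => [|t ts IH] /=.
  by move=> _; rewrite big_nil expr0n /= mul0r addr0.
move=> /andP[/allP tts /IH {}IH].
have row : \sum_(s <- ts) g t s <= (size ts)%:R * delta.
  rewrite big_seq (le_trans (ler_sum _ tts)) // -big_seq big_const_seq count_predT.
  by rewrite iter_addr_0 mulr_natl.
rewrite big_cons.
have -> : \sum_(s <- ts) \sum_(t0 <- t :: ts) g s t0 =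
    \sum_(s <- ts) g t s + \sum_(s <- ts) \sum_(t0 <- ts) g s t0.
  by rewrite -big_split; apply: eq_bigr => s _; rewrite big_cons gC.
rewrite big_cons -natr1; have := g1 t.
move: IH row; set a := \sum_(s <- ts) g t s; set b := \sum_(s <- ts) _.
by move: (size ts)%:R (ler0n R (size ts)) => n n0; nra.
Qed.

Lemma window_shift_le (c : int -> R) (M : int) (L t : nat) :
  (forall n, 0 <= c n <= 1) ->
  \sum_(1 <= k < L.+1) c (M + k%:Z) <=
  t%:R + \sum_(1 <= k < L.+1) c (M + k%:Z + t%:Z).
Proof.
move=> c01; have c0 n : 0 <= c n by have /andP[] := c01 n.
apply: (@le_trans _ _ (\sum_(1 <= k < (t + L).+1) c (M + k%:Z))).
  rewrite [leRHS](@big_cat_nat _ _ _ L.+1) //=; last by rewrite ltnS leq_addl.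
  by rewrite lerDl sumr_ge0.
rewrite (@big_cat_nat _ _ _ t.+1) //=; last by rewrite ltnS leq_addr.
apply: lerD.
  apply: (@le_trans _ _ (\sum_(1 <= k < t.+1) 1)).
    by apply: ler_sum_nat => k _; have /andP[] := c01 (M + k%:Z).
  by rewrite sumr_const_nat subSS subn0.
rewrite -{1}[t.+1]add1n big_addn subSn ?leq_addr // addKn.
by apply: ler_sum_nat => k _; rewrite PoszD addrA.
Qed.

(** Moving a window by each of the [K] times [ts] changes its sum by at most a fixed total. After
    exchanging the summations, Bessel's inequality bounds the [K] terms at each [n] by [K e / 4];
    this is uniform in [n], hence in the left end [M]. *)
Lemma weakly_mixing_shift : weakly_mixing (shift_mpt mu_translate).
Proof.
move=> A B mA mB e e0.
pose c n := `|cov mu A (translate n @^-1` B)|.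
have mtr n : measurable (translate n @^-1` B) := measurable_translate_preimage n mB.
have c01 n : 0 <= c n <= 1.
  by rewrite /c normr_ge0 ler_norml /=; apply: cov_itv.
(* Large enough for [2 K <= (K e / 4)^2], where [2 K] is the Bessel bound for [K] sets with pairwise
   covariances at most [1 / K]. *)
pose K := (Num.truncn (32 / e ^+ 2)).+1.
have K0 : (0 : R) < K%:R by rewrite ltr0n.
have Ke : 32 <= K%:R * e ^+ 2.
  by rewrite -ler_pdivrMr ?exprn_gt0 //; apply/ltW/truncnS_gt.
have [ts [tsK indep]] := almost_independent_gaps K mB (divr_gt0 ltr01 K0).
have bessel n : \sum_(t <- ts) c (n + t%:Z) <= K%:R * e / 4.
  have := @cov_bessel _ _ _ mu A [seq translate (n + t%:Z) @^-1` B | t : nat <- ts] mA.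
  rewrite !big_map => h.
  have {}h := h _; set S := \sum_(t <- ts) _.
  have S0 : 0 <= S by rewrite sumr_ge0 // => t _; have /andP[] := c01 (n + t%:Z).
  rewrite -(@ler_pXn2r _ 2) ?nnegrE //; last by rewrite divr_ge0 ?mulr_ge0 // ltW.
  apply: (@le_trans _ _ (K%:R + K%:R ^+ 2 * (1 / K%:R))); last first.
    have -> : K%:R + K%:R ^+ 2 * (1 / K%:R) = 2 * K%:R :> R by field; rewrite gt_eqF.
    have -> : (K%:R * e / 4) ^+ 2 = K%:R * (K%:R * e ^+ 2) / 16 :> R by field.
    nra.
  pose g (s t : nat) := `|cov mu (translate s @^-1` B) (translate t @^-1` B)|.
  have -> : S ^+ 2 = (\sum_(t <- ts) c (n + t%:Z)) ^+ 2 by [].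
  apply: le_trans (h _) _.
    by move=> E /mapP[t _ ->].
  have -> : \sum_(s <- ts) \sum_(F <- [seq translate (n + t%:Z) @^-1` B | t : nat <- ts])
      `|cov mu (translate (n + s%:Z) @^-1` B) F| = \sum_(s <- ts) \sum_(t <- ts) g s t.
    apply: eq_bigr => s _; rewrite big_map; apply: eq_bigr => t _.
    (* Stationarity removes the common translation by [n]. *)
    by rewrite -!translate_preimageD cov_translate.
  rewrite -tsK; apply: sum_pairwise_le => [s t|s||].
  - by rewrite /g covC.
  - by rewrite /g ler_norml; apply: cov_itv.
  - by rewrite divr_ge0 // ltW.
  - by rewrite tsK.
pose total : R := \sum_(t <- ts) t%:R.
near=> L; move=> M.
have L0 : (0 : R) < L%:R by rewrite ltr0n; near: L; exists 1%N.
have Ltotal : total <= L%:R * (e / 4).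
  rewrite -ler_pdivrMr ?divr_gt0 //; apply/ltW; near: L.
  exact: nbhs_infty_gtr.
pose W := \sum_(1 <= k < L.+1) c (M + k%:Z).
have W0 : 0 <= W by rewrite sumr_ge0 // => k _; have /andP[] := c01 (M + k%:Z).
have -> : \sum_(1 <= k < L.+1) correlation_defect (shift_mpt mu_translate) A B (M + k%:Z) = W.
  apply: eq_bigr => k _; rewrite /correlation_defect mpt_pow_shift.
  by rewrite /c /cov pr_translate.
have KW : K%:R * W <= total + L%:R * (K%:R * e / 4).
  have -> : K%:R * W = \sum_(t <- ts) W.
    by rewrite big_const_seq count_predT iter_addr_0 tsK mulr_natl.
  apply: (@le_trans _ _ (\sum_(t <- ts)
      (t%:R + \sum_(1 <= k < L.+1) c (M + k%:Z + t%:Z)))).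
    by apply: ler_sum => t _; apply: window_shift_le.
  rewrite big_split /= lerD2l exchange_big /=.
  apply: (@le_trans _ _ (\sum_(1 <= k < L.+1) (K%:R * e / 4))).
    by apply: ler_sum_nat => k _; apply: bessel.
  by rewrite sumr_const_nat subSS subn0 -[_ *+ L]mulr_natl.
rewrite ger0_norm ?mulr_ge0 ?invr_ge0 // mulrC ltr_pdivrMr //.
rewrite -(ltr_pM2l K0); apply: (le_lt_trans KW).
have K1 : (1 : R) <= K%:R by rewrite ler1n.
have LKe : L%:R * (e / 4) <= L%:R * (K%:R * e / 4).
  by rewrite ler_wpM2l // ler_wpM2r // ler_peMl // ltW.
have LKe0 : 0 < L%:R * (K%:R * e / 4) by rewrite mulr_gt0 // divr_gt0 // mulr_gt0.
have -> : K%:R * (e * L%:R) = 4 * (L%:R * (K%:R * e / 4)) :> R by field.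
lra.
Unshelve. all: by end_near. Qed.

End WeakMixing.

(** * The limit process *)

Section CoinMean.
Variable R : realFieldType.

Let coin_ev (F : (int -> bool) -> R) := (F (fun=> true) + F (fun=> false)) / 2.

Let coin_lin a F G : coin_ev (fun f => a * F f + G f) = a * coin_ev F + coin_ev G.
Proof. by rewrite /coin_ev; ring. Qed.

Let coin_ge0 F : (forall f, 0 <= F f) -> 0 <= coin_ev F.
Proof. by move=> F0; rewrite divr_ge0 ?addr_ge0. Qed.

Let coin1 : coin_ev (fun=> 1) = 1.
Proof. by rewrite /coin_ev; field. Qed.

Let coin_flip F : coin_ev (fun f => F (fun z => ~~ f z)) = coin_ev F.
Proof. by rewrite /coin_ev addrC. Qed.

(** A constant path with a fair random sign, from which the iteration starts. *)
Definition coin_mean : mean R :=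
  Mean coin_lin coin_ge0 coin1 (fun=> erefl) coin_flip.

End CoinMean.

(** The errors from stage [k] on add up to [2 eps_k]; the factor 1/16 leads to the final bound
    7/32. *)
Definition eps_at (R : realType) (k : nat) : R := 2^-1 ^+ k / 16.

Lemma eps_at_gt0 R k : 0 < eps_at R k.
Proof. by rewrite divr_gt0 // exprn_gt0 // invr_gt0. Qed.

Lemma eps_atS R k : eps_at R k.+1 = eps_at R k / 2.
Proof. by rewrite /eps_at exprS; field. Qed.

Lemma eps_at_le R k : eps_at R k <= 1 / 16.
Proof. by rewrite ler_pM2r ?invr_gt0 // exprn_ile1 ?invr_ge0 // invf_le1 // ler1n. Qed.

Lemma cvg_eps_at R : eps_at R @ \oo --> 0.
Proof.
rewrite -[X in _ --> X](mul0r (16^-1 : R)); apply: cvgMl.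
by apply: cvg_expr; rewrite ger0_norm ?invr_ge0 // invf_lt1 // ltr1n.
Qed.

(** Stage [k] provides an IP_k set, so that one limit process serves every [r]. *)
Lemma stages_exist (R : realType) (d : nat) (p : mpoly d int) :
  (2 < msize p)%N -> mcoeff mnm0 p = 0 ->
  exists (E : nat -> mean R) (L N : nat -> nat),
    forall k, stage_spec p k (eps_at R k) (E k) (E k.+1) (L k) (L k.+1) (N k).
Proof.
move=> sp p0.
pose spec (x : nat * (mean R * nat)) (y : (mean R * nat) * nat) :=
  stage_spec p x.1 (eps_at R x.1) x.2.1 y.1.1 x.2.2 y.1.2 y.2.
have step x : exists y, spec x y.
  have [E' [N [L' h]]] := stage_exists x.2.1 x.2.2 x.1 sp p0 (eps_at_gt0 R x.1).
  by exists ((E', L'), N).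
have [next nextP] := boolp.choice step.
pose state := fix state k : mean R * nat :=
  if k is k'.+1 then (next (k', state k')).1 else (coin_mean R, 0%N).
exists (fun k => (state k).1), (fun k => (state k).2), (fun k => (next (k, state k)).2).
by move=> k; have := nextP (k, state k); rewrite /spec /=; case: (state k).
Qed.

Lemma product_approx (R : realFieldType) (g g' a a' b b' e : R) :
  `|g - g'| <= e -> `|g' - a' * b'| <= e ->
  `|a - a'| <= 2 * e -> `|b - b'| <= 2 * e -> 0 <= a' <= 1 -> 0 <= b <= 1 ->
  `|g - a * b| <= 6 * e.
Proof.
move=> hg hg' ha hb /andP[a0 a1] /andP[b0 b1].
have -> : g - a * b = (g - g') + (g' - a' * b') - (a' * (b - b') + b * (a - a')) by ring.
have e0 : 0 <= 2 * e by apply: le_trans ha.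
have h1 : `|a' * (b - b')| <= 2 * e.
  by rewrite normrM ger0_norm // -[leRHS]mul1r ler_pM.
have h2 : `|b * (a - a')| <= 2 * e.
  by rewrite normrM ger0_norm // -[leRHS]mul1r ler_pM.
rewrite (le_trans (ler_normB _ _)) //.
have := ler_normD (g - g') (g' - a' * b'); have := ler_normD (a' * (b - b')) (b * (a - a')).
by lra.
Qed.

Section LimitSystem.
Variables (R : realType) (d : nat) (p : mpoly d int).
Variables (E : nat -> mean R) (L N : nat -> nat).
Hypothesis stages : forall k, stage_spec p k (eps_at R k) (E k) (E k.+1) (L k) (L k.+1) (N k).
Local Notation eps := (eps_at R).
Local Notation bev k G := (E k (fun f => (G f)%:R)).

Lemma window_ge k : (k <= L k)%N.
Proof. by elim: k => // k IH; have [_ h _ _] := stages k; apply: leq_ltn_trans h. Qed.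

Lemma window_le j k : (j <= k)%N -> (L j <= L k)%N.
Proof.
elim: k => [|k IH]; first by rewrite leqn0 => /eqP->.
rewrite leq_eqVlt => /predU1P[->//|/IH h].
by have [_ h' _ _] := stages k; apply: leq_trans h (ltnW h').
Qed.

Lemma bev_itv k (G : (int -> bool) -> bool) : 0 <= bev k G <= 1.
Proof. by apply: ev_itv => f; case: (G f); rewrite ?lexx ler01. Qed.

Lemma bev_step k (G : (int -> bool) -> bool) : local (L k) G ->
  `|bev k.+1 G - bev k G| <= eps k.
Proof.
move=> GL; have [_ _ /(_ G (fun=> true) GL (fun _ _ _ => erefl)) + _] := stages k.
rewrite ev1 mulr1; congr (`|_ - _| <= _).
by apply: eq_ev => f; rewrite andbT.
Qed.

(** The bound is exactly the sum of the errors of stages [k] to [k + i - 1], which makes the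
    induction close. *)
Lemma bev_dist k i (G : (int -> bool) -> bool) : local (L k) G ->
  `|bev (k + i) G - bev k G| <= 2 * eps k - 2 * eps (k + i).
Proof.
move=> GL; elim: i => [|i IH]; first by rewrite addn0 !subrr normr0.
have := bev_step (local_widen (window_le (leq_addr i k)) GL).
move: IH; rewrite addnS eps_atS => h1 h2.
rewrite -(subrKA (bev (k + i) G)) (le_trans (ler_normD _ _)) //.
by rewrite (le_trans (lerD h2 h1)) //; lra.
Qed.

Lemma bev_cvg l (G : (int -> bool) -> bool) : local l G -> cvgn (fun k => bev k G).
Proof.
move=> Gl; apply/cauchy_cvgP/cauchy_exP => e e0.
have : \forall k \near \oo, 2 * eps k < e.
  have := @cvg_eps_at R; move/cvgrPdist_lt/(_ (e / 2)); rewrite divr_gt0 // => /(_ isT) h.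
  near=> k; have : `|0 - eps k| < e / 2 by near: k; exact: h.
  by rewrite sub0r normrN gtr0_norm ?eps_at_gt0 //; lra.
move=> [k0 _ hk]; pose k := maxn k0 l.
exists (bev k G); exists k => // j /= kj; rewrite /ball /= distrC.
have GL : local (L k) G.
  by apply: local_widen Gl; apply: leq_trans (window_ge k); apply: leq_maxr.
have := bev_dist (j - k) GL; rewrite subnKC // => h.
apply: (le_lt_trans h); apply: le_lt_trans (hk k (leq_maxl _ _)).
by have := eps_at_gt0 R j; lra.
Unshelve. all: by end_near. Qed.

Lemma limit_system_exists : exists (mu : probability path_space R)
    (mu_translate : forall m l (G : (int -> bool) -> bool), local l G ->
      mu [set f | G (translate m f)] = mu [set f | G f]),
  [/\ weakly_mixing (shift_mpt mu_translate),
    mu [set f : path_space | f 0] = (1 / 2)%:E &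
    forall r, exists2 n : 'I_r -> 'rV[int]_d, injective n &
      forall J : {set 'I_r}, J != finset.set0 ->
        pr mu [set f : path_space | f 0 && f (eval_at p (\sum_(j in J) n j))] <= 7 / 32].
Proof.
have [mu mu_lim] := limit_measure bev_cvg.
have mu_translate m l (G : (int -> bool) -> bool) : local l G ->
    mu [set f | G (translate m f)] = mu [set f | G f].
  move=> Gl; have Gm := local_shift (m := m) Gl.
  have e : fine (mu [set f | G (translate m f)]) = fine (mu [set f | G f]).
    apply: (cvg_unique _ (mu_lim _ _ Gm)) => //.
    rewrite (_ : (fun k => _) = (fun k => bev k G)); first exact: mu_lim Gl.
    by apply/funext => k; apply: (ev_shift (E k) m (fun f => (G f)%:R)).
  by rewrite -[LHS]fineK ?e ?fineK // fin_num_measure //;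
    [exact: measurable_local Gl|exact: measurable_local Gm].
have pr_dist k (G : (int -> bool) -> bool) : local (L k) G ->
    `|pr mu [set f | G f] - bev k G| <= 2 * eps k.
  move=> GL; apply/ler_addgt0Pr => e e0.
  have := mu_lim _ _ GL; move=> /cvgrPdist_le/(_ _ e0) [j0 _ hj].
  have := hj (k + j0)%N (leq_addl _ _); have := bev_dist j0 GL => /= h1 h2.
  rewrite -(subrKA (bev (k + j0) G)) (le_trans (ler_normD _ _)) //.
  rewrite addrC lerD //; apply: (le_trans h1).
  by rewrite lerBlDr lerDl mulr_ge0 // ltW // eps_at_gt0.
exists mu, mu_translate; split.
- apply: (weakly_mixing_shift mu_translate (gap := N)).
  move=> l1 l2 G1 G2 G1l G2l; apply/cvgrPdist_le => e e0.
  have small : \forall k \near \oo, 6 * eps k <= e.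
    have := @cvg_eps_at R; move/cvgrPdist_lt/(_ (e / 6)); rewrite divr_gt0 // => /(_ isT) h.
    near=> k; have : `|0 - eps k| < e / 6 by near: k; exact: h.
    by rewrite sub0r normrN gtr0_norm ?eps_at_gt0 //; lra.
  near=> k; have ke : 6 * eps k <= e by near: k; exact: small.
  have kl : (maxn l1 l2 <= k)%N by near: k; exists (maxn l1 l2).
  have G1L : local (L k) G1.
    by apply: local_widen G1l; rewrite (leq_trans _ (window_ge k)) // (leq_trans (leq_maxl _ _) kl).
  have G2L : local (L k) G2.
    by apply: local_widen G2l; rewrite (leq_trans _ (window_ge k)) // (leq_trans (leq_maxr _ _) kl).
  (* As [L k + N k <= L k.+1], the joint event at gap [N k] lies in the window of the next stage, so
     later stages preserve its probability up to [2 eps k.+1]. *)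
  have [LN _ /(_ _ _ G1L G2L) mix _] := stages k.
  pose G f := G1 f && G2 (fun z => f (z + (N k)%:Z)).
  have GL : local (L k.+1) G.
    move=> f g fg; rewrite /G (G1L f g) => [|z zL]; last by apply: fg; lia.
    by rewrite (local_shift (m := (N k)%:Z) G2L (f := f) (g := g)) // => z zL; apply: fg; lia.
  rewrite sub0r normrN (le_trans _ ke) // /cov pr_translate //; last exact: measurable_local G2l.
  rewrite (_ : [set f | G1 f] `&` _ = [set f | G f]); last first.
    by apply/seteqP; split=> f /=; [case=> h1 h2; rewrite /G h1|rewrite /G => /andP].
  have hG := pr_dist _ _ GL; rewrite eps_atS mulrCA divff // mulr1 in hG.
  exact: (product_approx hG mix (pr_dist _ _ G1L) (pr_dist _ _ G2L)
    (bev_itv k G1) (pr_itv mu (measurable_local G2l))).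
- have A_local : local 1 (fun f : int -> bool => f 0) by move=> f g fg; apply: fg.
  have half k : bev k (fun f : int -> bool => f 0) = 1 / 2.
    have := ev1 (E k).
    rewrite (_ : (fun=> 1) = fun f : int -> bool => (f 0)%:R + (~~ f 0)%:R); last first.
      by apply/funext => f; case: (f 0); rewrite ?addr0 ?add0r.
    rewrite evD (ev_flip (E k) (fun f : int -> bool => (f 0)%:R)) => h; lra.
  rewrite -[LHS]fineK ?fin_num_measure //; last exact: measurable_local A_local.
  congr EFin; apply: (cvg_unique _ (mu_lim _ _ A_local)) => //.
  by rewrite (_ : (fun k => _) = fun=> 1 / 2); [exact: cvg_cst|apply/funext].
- move=> r; have [_ _ _ [n n_inj nJ]] := stages r; exists n => // J J0.
  have [] := nJ J J0; set m := eval_at p _ => mL h.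
  have GL : local (L r.+1) (fun f : int -> bool => f 0 && f m).
    by move=> f g fg; rewrite !fg //; lia.
  have := pr_dist _ _ GL; rewrite ler_norml eps_atS.
  (* Negation exchanges the two ways in which [f 0] and [f m] can agree. *)
  have -> : bev r.+1 (fun f => f 0 && f m) = bev r.+1 (fun f => f 0 == f m) / 2.
    have -> : bev r.+1 (fun f => f 0 == f m) =
        E r.+1 (fun f => (f 0 && f m)%:R + (~~ f 0 && ~~ f m)%:R).
      by apply: eq_ev => f; case: (f 0); case: (f m); rewrite ?addr0 ?add0r.
    by rewrite evD (ev_flip (E r.+1) (fun f => (f 0 && f m)%:R)); field.
  (* The total is at most [1/8 + eps r / 2 + eps r], where [eps r <= 1/16]. *)
  by have := eps_at_le R r; lra.
Unshelve. all: by end_near. Qed.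

End LimitSystem.

Theorem theorem1p13 (R : realType) (d : nat) (hd : (0 < d)%N)
    (p : mpoly d int) (hconst : nonconstant p) (hlin : nonlinear p)
    (h0 : zero_constant_term p) :
  exists (disp : measure_display) (X : measurableType disp)
    (mu : probability X R) (T : invertible_mpt mu) (A : set X) (epsilon : R),
    [/\ weakly_mixing T, measurable A, (0 < mu A)%E, 0 < epsilon &
      ~ is_IP0_star [set n : 'rV[int]_d |
          ((mu A) ^+ 2 - epsilon%:E
             < mu (A `&` mpt_pow T (eval_at p n) @^-1` A))%E]].
Proof.
have sp : (2 < msize p)%N.
  by rewrite ltn_neqAle eq_sym; apply/andP; split; [apply/eqP|].
have [E [L [N stages]]] := stages_exist R sp h0.
have [mu [mu_translate [wm muA returns]]] := limit_system_exists stages.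
have mA : measurable [set f : path_space | f 0].
  by apply: (@measurable_local 1%N (fun f : path_space => f 0)) => f g fg; apply: fg.
(* Here [(mu A)^2 - 1/32 = 7/32], the bound on the returns along the whole IP_r set. *)
exists _, path_space, mu, (shift_mpt mu_translate), [set f : path_space | f 0], (1 / 32).
split=> //; first by rewrite muA lte_fin.
move=> [r r0 star]; have [n n_inj nJ] := returns r.
have [] := star [set \sum_(j in J) n j | J in [set J : {set 'I_r} | J != finset.set0]].
  by exists n.
move=> x [/= small [J /= J0 Jx]]; have := nJ J J0; apply/negP; rewrite -ltNge.
move: small; rewrite -Jx muA mpt_pow_shift.
set m := eval_at p _.
have -> : [set f : path_space | f 0] `&` translate m @^-1` [set f : path_space | f 0] =
    [set f : path_space | f 0 && f m].
  by apply/seteqP; split=> f /=; rewrite /translate add0r => /andP.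
have mAm : measurable [set f : path_space | f 0 && f m].
  apply: (@measurable_local `|m|.+1 (fun f : path_space => f 0 && f m)) => f g fg.
  by rewrite !fg //; lia.
rewrite -[mu _](@fineK _ (mu [set f : path_space | f 0 && f m])) ?fin_num_measure //.
rewrite -EFinM -EFinD lte_fin /pr; lra.
Qed.
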